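(* Let $(\mathcal{H}, * )$ be a semigroup. Then the following conditions (i) and (ii) are equivalent: (i) There are a nonempty set $X$ and a nondiscrete, strongly rigid pseudometric $d \colon X^{2} \to \mathbb{R}$ such that the semigroup $(\mathcal{H}, * )$ is isomorphic to $\mathcal{B}_X(P_{d^{-1}})$. (ii) The semigroup $(\mathcal{H}, * )$ is obtained by adjunction of an identity element to a semigroup $\widehat{\mathcal{H}}$ for which the following statements hold: $(ii_1)$ $\widehat{\mathcal{H}}$ is a band of subsemigroups with core $\mathcal{C}$, $\widehat{\mathcal{H}} \approx \{\mathcal{H}_\alpha \colon \alpha \in \Omega\} \sqcup \mathcal{C}$, such that $\mathcal{C} \in \mathbf{H}_{1}$ and $\mathcal{H}_{\alpha}$ is a group of order $2$ for every $\alpha \in \Omega$. $(ii_2)$ The double inequality $3 \leqslant |\Omega| \leqslant \mathfrak{c}$ holds. $(ii_3)$ The set $\widehat{E}$ of all idempotents of $\widehat{\mathcal{H}}$ is a commutative band. $(ii_4)$ If $e_1$, $e_2$ are two distinct nontrivial idempotents of $\mathcal{C}$, then there is a unique $e \in \widehat{E}\setminus \mathcal{C}$ such that $$e_1 = e_1*e \quad \text{and} \quad e_2 = e_2*e. \qquad (\star)$$ Conversely, if $e \in \widehat{E} \setminus \mathcal{C}$, then there are exactly two distinct nontrivial $e_1, e_2 \in \mathcal{C} \cap \widehat{E}$ such that $(\star)$ holds. $(ii_5)$ For every $x \in \widehat{E} \cap \mathcal{C}$ and every $y \in \widehat{\mathcal{H}} \setminus \widehat{E}$, the equality $x*y=\theta$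 holds if and only if $x*y$ is idempotent, and the equality $y*x=\theta$ holds if and only if $y*x$ is idempotent.
   Context: $\mathfrak{c}$ is the cardinality of the continuum. Pseudometrics. A pseudometric on $X$ is a function $d\colon X^2\to\mathbb{R}$ that is nonnegative, symmetric, satisfies $d(x,x)=0$ for all $x\in X$, and satisfies the triangle inequality. It is discrete if $|d(X^2)|\leqslant 2$, and nondiscrete otherwise. It is strongly rigid if, for all $x,y,u,v\in X$, $d(x,y)=d(u,v)\neq 0$ implies that ($d(x,u)=0$ and $d(y,v)=0$) or ($d(x,v)=0$ and $d(y,u)=0$). Semigroups of relations. $\mathcal{B}_X$ is the semigroup of all binary relations on $X$ (subsets of $X^2$) under composition: $\langle x,y\rangle\in\psi\circ\gamma$ iff there is $z\in X$ with $\langle x,z\rangle\in\psi$ and $\langle z,y\rangle\in\gamma$. For nonempty $A\subseteq\mathcal{B}_X$, $\mathcal{B}_X(A)$ is the subsemigroup generated by $A$. $P_{d^{-1}}:=\{d^{-1}(r):r\in d(X^2)\}$ is the set of fibers of $d$. Semigroup notions. A semigroup is a nonempty set with an associative multiplication $*$; a subsemigroup is a nonempty subset closed under multiplication; for nonempty subsets, $A*B=\{x*y:x\in A,\ y\in B\}$. An ideal of $\mathcal{H}$ is a subsemigroup $\mathcal{H}_1$ with $\mathcal{H}_1*\mathcal{H}\subseteq\mathcal{H}_1$ and $\mathcal{H}*\mathcal{H}_1\subseteq\mathcal{H}_1$. The semigroup obtained from $(\mathcal{S},* )$ by adjunction of an identity element is $\mathcal{S}^1$, where $\mathcal{S}^1=\mathcal{S}$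 if $\mathcal{S}$ has an identity element, and otherwise $\mathcal{S}^1=\mathcal{S}\cup\{e\}$ with $e\notin\mathcal{S}$, the multiplication being extended by $e*e=e$ and $e*x=x*e=x$ for $x\in\mathcal{S}$. If $|\mathcal{S}|=1$, its only element is regarded as the identity element. If $|\mathcal{S}|\geqslant 2$, a zero element of $\mathcal{S}$ is an element $\theta$ with $\theta*s=s*\theta=\theta$ for all $s\in\mathcal{S}$. An idempotent is an element $i$ with $i*i=i$; a nontrivial idempotent of a semigroup is an idempotent which is not the zero element (if a zero exists) and not the identity element (if an identity exists) of that semigroup. A band is a semigroup all of whose elements are idempotent. Band of subsemigroups with core. Let $\mathcal{C}$ be an ideal of a semigroup $(\mathcal{H},* )$. $\mathcal{H}$ is a band of subsemigroups with core $\mathcal{C}$, written $\mathcal{H}\approx\{\mathcal{H}_\alpha:\alpha\in\Omega\}\sqcup\mathcal{C}$, if $\mathcal{C}\neq\mathcal{H}$ and $\{\mathcal{H}_\alpha:\alpha\in\Omega\}$ is a partition of $\mathcal{H}\setminus\mathcal{C}$ (with $\mathcal{H}_\alpha$ distinct for distinct $\alpha$) such that every $\mathcal{H}_\alpha$ is a subsemigroup of $\mathcal{H}$ and $\mathcal{H}_{\alpha_1}*\mathcal{H}_{\alpha_2}\subseteq\mathcal{C}$ for all distinct $\alpha_1,\alpha_2\in\Omega$. The class $\mathbf{H}_1$. $\mathbf{H}_1$ is the class of all semigroups $(\mathcal{H},* )$ such that either $|\mathcal{H}|=1$ or the following hold: (1) $\mathcal{H}$ contains a zero element $\theta$. (2)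 $x*y=\theta$ for all distinct idempotent elements $x,y\in\mathcal{H}$. (3) If $i_l$ and $i_r$ are nontrivial idempotent elements of $\mathcal{H}$, then there is a unique nonzero $a\in\mathcal{H}$ such that $a=i_l*a*i_r$. (4) For every nonzero $a\in\mathcal{H}$ there is a unique pair $(i_{la},i_{ra})$ of nontrivial idempotent elements of $\mathcal{H}$ such that $a=i_{la}*a*i_{ra}$. (5) For all nonzero $a,b\in\mathcal{H}$ and all pairs $(i_{la},i_{ra})$ and $(i_{lb},i_{rb})$ of nontrivial idempotent elements of $\mathcal{H}$ such that $a=i_{la}*a*i_{ra}$, $b=i_{lb}*b*i_{rb}$ and $i_{ra}=i_{lb}$, it holds that $a*b\neq\theta$. In (ii), ''nontrivial'' refers to nontrivial idempotents of the semigroup $\mathcal{C}$, and $\theta$ denotes the zero element of $\widehat{\mathcal{H}}$ (which is also the zero element of $\mathcal{C}$ when $|\mathcal{C}|\geqslant 2$). *)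

(* Defs.v *)
From HB Require Import structures.
From mathcomp Require Import all_boot all_order all_algebra.
From mathcomp Require Import all_classical all_reals.

Set Implicit Arguments.
Unset Strict Implicit.
Unset Printing Implicit Defensive.

Import Order.TTheory GRing.Theory Num.Theory.
Local Open Scope classical_set_scope.
Local Open Scope card_scope.
Local Open Scope ring_scope.

Definition pseudometric (R : realType) (X : Type) (d : X * X -> R) : Prop :=
  [/\ forall x y, 0 <= d (x, y),
      forall x y, d (x, y) = d (y, x),
      forall x, d (x, x) = 0
    & forall x y z, d (x, z) <= d (x, y) + d (y, z)].

Definition discrete_pseudometric (R : realType) (X : Type) (d : X * X -> R)
    : Prop :=
  range d #<= `I_2.

Definition strongly_rigid (R : realType) (X : Type) (d : X * X -> R) : Prop :=
  forall x y u v, d (x, y) = d (u, v) -> d (u, v) <> 0 ->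
    (d (x, u) = 0 /\ d (y, v) = 0) \/ (d (x, v) = 0 /\ d (y, u) = 0).

Definition fibers (R : realType) (X : Type) (d : X * X -> R)
    : set (set (X * X)) :=
  [set d @^-1` [set r] | r in range d].

Definition binrel (X : Type) : Type := set (X * X).

HB.instance Definition _ (X : Type) := Choice.copy (binrel X) (set (X * X)).

Definition relcomp (X : Type) (psi gamma : binrel X) : binrel X :=
  [set xy | exists2 z, psi (xy.1, z) & gamma (z, xy.2)].

Lemma relcompA (X : Type) : associative (@relcomp X).
Proof.
move=> a b c; apply/seteqP; split=> -[x y] /=.
- by case=> z axz [t bzt cty]; exists t => //; exists z.
- by case=> t [z axz bzt] cty; exists z => //; exists t.
Qed.

HB.instance Definition _ (X : Type) :=
  isSemigroup.Build (binrel X) (@relcompA X).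

Local Open Scope group_scope.

(* A subsemigroup A of S is itself regarded as a semigroup: every notion below
   that takes a set A (zero, identity, nontrivial idempotent, ideal, group,
   class H_1, ...) refers to the semigroup with carrier A, not to S. *)

Definition setmul (S : semigroupType) (A B : set S) : set S :=
  [set x * y | x in A & y in B].

Definition subsemigroup (S : semigroupType) (A : set S) : Prop :=
  A !=set0 /\ setmul A A `<=` A.

Definition generated (S : semigroupType) (A : set S) : set S :=
  smallest (@subsemigroup S) A.

Definition isomorphic (S T : semigroupType) (A : set S) (B : set T) : Prop :=
  exists2 f : S -> T, set_bij A B f &
    forall x y, A x -> A y -> f (x * y) = f x * f y.

(* [B] is an ideal of [A]. *)
Definition ideal (S : semigroupType) (A B : set S) : Prop :=
  [/\ subsemigroup B, B `<=` A, setmul B A `<=` B & setmul A B `<=` B].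

Definition is_identity (S : semigroupType) (A : set S) (e : S) : Prop :=
  A e /\ forall x, A x -> e * x = x /\ x * e = x.

(* A one-element semigroup has an identity but, by convention, no zero. *)
Definition is_zero (S : semigroupType) (A : set S) (theta : S) : Prop :=
  [/\ `I_2 #<= A, A theta & forall x, A x -> theta * x = theta /\ x * theta = theta].

Definition idempotents (S : semigroupType) (A : set S) : set S :=
  [set i | A i /\ i * i = i].

Definition nontrivial_idempotent (S : semigroupType) (A : set S) (i : S)
    : Prop :=
  [/\ idempotents A i, ~ is_zero A i & ~ is_identity A i].

Definition commutative_band (S : semigroupType) (A : set S) : Prop :=
  [/\ subsemigroup A,
      forall x, A x -> x * x = x
    & forall x y, A x -> A y -> x * y = y * x].

Definition is_group (S : semigroupType) (A : set S) : Prop :=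
  subsemigroup A /\
  exists2 e, is_identity A e &
    forall x, A x -> exists2 y, A y & x * y = e /\ y * x = e.

(* [B] is [A] with an identity element adjoined, i.e. B = A^1. *)
Definition adjunction_identity (S : semigroupType) (A B : set S) : Prop :=
  ((exists e, is_identity A e) /\ B = A) \/
  (~ (exists e, is_identity A e) /\
   exists e, [/\ ~ A e, B = A `|` [set e], e * e = e
               & forall x, A x -> e * x = x /\ x * e = x]).

(* [A ~ {Ha i : i in I} \sqcup C]; [partition] makes the blocks nonempty and
   pairwise disjoint, hence distinct for distinct indices. *)
Definition band_with_core (S : semigroupType) (A : set S)
    (I : Type) (Ha : I -> set S) (C : set S) : Prop :=
  [/\ ideal A C,
      C <> A,
      partition [set: I] Ha (A `\` C),
      forall i, subsemigroup (Ha i)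
    & forall i j, i <> j -> setmul (Ha i) (Ha j) `<=` C].

Definition class_H1 (S : semigroupType) (A : set S) : Prop :=
  subsemigroup A /\
  (A #= `I_1 \/
   exists theta,
   [/\ is_zero A theta,
       forall x y, idempotents A x -> idempotents A y -> x <> y ->
         x * y = theta,
       forall il ir, nontrivial_idempotent A il -> nontrivial_idempotent A ir ->
         exists! a, [/\ A a, a <> theta & a = il * a * ir],
       forall a, A a -> a <> theta ->
         exists! p : S * S, [/\ nontrivial_idempotent A p.1,
           nontrivial_idempotent A p.2 & a = p.1 * a * p.2]
     & forall a b ila ira ilb irb,
         A a -> a <> theta -> A b -> b <> theta ->
         nontrivial_idempotent A ila -> nontrivial_idempotent A ira ->
         nontrivial_idempotent A ilb -> nontrivial_idempotent A irb ->
         a = ila * a * ira -> b = ilb * b * irb -> ira = ilb ->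
         a * b <> theta]).

Definition star_pair (S : semigroupType) (C : set S) (e e1 e2 : S) : Prop :=
  [/\ nontrivial_idempotent C e1, nontrivial_idempotent C e2, e1 <> e2,
      e1 = e1 * e & e2 = e2 * e].

(* Main.v *)
Require Import Defs.
From HB Require Import structures.
From mathcomp Require Import all_boot all_order all_algebra.
From mathcomp Require Import all_classical all_reals.
From mathcomp Require Import lra.

(* A strongly rigid pseudometric identifies the points at distance 0 and gives
   distinct distances to distinct unordered pairs of the resulting classes.
   Passing to the set I of classes, the fibers become the equality relation and
   the transpositions {(i,j), (j,i)}; these generate exactly the equality, the
   relations with at most one element, the transpositions and their squares
   {(i,i), (j,j)}, as soon as |I| >= 3.  So (i) says that H is isomorphic to
   this semigroup [rigid] for some I whose unordered pairs inject into R.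

   Conversely, given (ii), take for I the nontrivial idempotents of the core
   and represent x by the relation {(i,j) | i * x * j <> theta}.  The class H_1
   makes this multiplicative and faithful on the core; by (ii_4) the identity
   of a block acts as {(i,i), (j,j)} for a pair {i,j} determining the block, and
   by (ii_5) its other element has no fixed point, hence acts as the
   transposition. *)

Set Implicit Arguments.
Unset Strict Implicit.
Unset Printing Implicit Defensive.

Local Open Scope classical_set_scope.
Local Open Scope card_scope.
Local Open Scope group_scope.

Ltac cases := repeat match goal with
 | H : _ /\ _ |- _ => case: H => ? ?
 | H : _ \/ _ |- _ => case: H => ?
 | H : exists _, _ |- _ => case: H => ? ?
 end; cbn in *.

(** * Rigid relations *)

Definition equality_rel {I : Type} : binrel I := fun p => p.1 = p.2.
Definition single {I : Type} (i j : I) : binrel I :=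
  fun p => p.1 = i /\ p.2 = j.
Definition swap {I : Type} (i j : I) : binrel I :=
  fun p => p.1 = i /\ p.2 = j \/ p.1 = j /\ p.2 = i.
Definition pair_id {I : Type} (i j : I) : binrel I :=
  fun p => p.1 = p.2 /\ (p.1 = i \/ p.1 = j).

Arguments equality_rel I p /.
Arguments single I i j p /.
Arguments swap I i j p /.
Arguments pair_id I i j p /.

Section Relations.
Variable I : Type.
Implicit Types (i j k l : I) (r s t : binrel I).

(** The group of order 2 attached to the pair {i,j}: [pair_id i j] is its identity and [swap i j]
    the other element. *)
Definition two i j r : Prop := r = swap i j \/ r = pair_id i j.

(** These relations form the core: the empty one is its zero, and the singletons multiply like
    matrix units. *)
Definition small r : Prop := forall p q, r p -> r q -> p = q.

(** The graph of an injective partial map. Composing with such a relation on either side keeps a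
    [small] relation small. *)
Definition partial_injection r : Prop :=
  forall i j k l, r (i, j) -> r (k, l) -> (i = k <-> j = l).

(** The closed form of the semigroup generated by [swap_generators] once [I] has three points, see
    [rigid_eq_generated]. *)
Definition rigid r : Prop :=
  [\/ r = equality_rel, small r | exists i j, i <> j /\ two i j r].

Definition swap_generators : set (binrel I) :=
  [set r | r = equality_rel \/ exists i j, i <> j /\ r = swap i j].

Lemma mulrelE r s i j : (r * s)%g (i, j) <-> exists2 k, r (i, k) & s (k, j).
Proof. by []. Qed.

Lemma rel_eqP r s : (forall i j, r (i, j) <-> s (i, j)) -> r = s.
Proof. by move=> h; apply/seteqP; split=> -[i j] /h. Qed.

Lemma equality_mul r : equality_rel * r = r.
Proof.
by apply: rel_eqP => i j; split=> [[k /= <-]//|rij]; exists i.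
Qed.

Lemma mul_equality r : r * equality_rel = r.
Proof.
by apply: rel_eqP => i j; split=> [[k /= rik <-]//|rij]; exists j.
Qed.

Lemma small_set0 : small set0. Proof. by []. Qed.

Lemma small_single i j : small (single i j).
Proof. by move=> [a b] [c d] /= [-> ->] [-> ->]. Qed.

Lemma smallP r : small r -> r = set0 \/ exists i j, r = single i j.
Proof.
move=> sr; case: (eqVneq r set0) => [->|/set0P[[i j] rij]]; first by left.
right; exists i, j; apply: rel_eqP => k l; split=> [rkl|[/= -> ->]//].
by have [-> ->] := sr _ _ rkl rij.
Qed.

Lemma two_sym i j r : two i j r -> two j i r.
Proof.
by case=> ->; [left|right]; apply: rel_eqP => k l /=; tauto.
Qed.

Lemma small_partial_injection r : small r -> partial_injection r.
Proof. by move=> sr i j k l rij rkl; have [-> ->] := sr _ _ rij rkl. Qed.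

Lemma two_partial_injection i j r : two i j r -> partial_injection r.
Proof.
case=> -> a b c d; rewrite /swap /pair_id /= => h1 h2; cases; split; congruence.
Qed.

Lemma rigid_partial_injection r : rigid r -> partial_injection r.
Proof.
case=> [->|/small_partial_injection//|[i [j [_ /two_partial_injection]]]//].
by move=> i j k l /= -> ->.
Qed.

Lemma small_mulr r s : small r -> partial_injection s -> small (r * s).
Proof.
move=> sr hs [i j] [k l] [/= a ria saj] [b /= rkb sbl].
have [ik ab] := sr _ _ ria rkb.
by rewrite ik; congr pair; apply/(hs _ _ _ _ saj sbl).
Qed.

Lemma small_mull r s : partial_injection r -> small s -> small (r * s).
Proof.
move=> hr ss [i j] [k l] [/= a ria saj] [b /= rkb sbl].
have [ab jl] := ss _ _ saj sbl.
by rewrite jl; congr pair; apply/(hr _ _ _ _ ria rkb).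
Qed.

Lemma two_mul_same i j r s :
  i <> j -> two i j r -> two i j s -> two i j (r * s).
Proof.
move=> nij [] -> [] ->; [right|left|left|right]; apply: rel_eqP => a b;
  rewrite mulrelE /swap /pair_id /=; split=> [[c h h']|h];
  try (by cases; subst; tauto).
- by cases; subst; [exists j|exists i]; tauto.
- by cases; subst; [exists j|exists i]; tauto.
- by cases; subst; [exists i|exists j]; tauto.
- by cases; subst; [exists i|exists j]; tauto.
Qed.

(** Every pair of [r * s] passes through a point common to {i,j} and {k,l}. Different pairs share at
    most one point, and partial injectivity then determines both ends. *)
Lemma two_mul_diff i j k l r s : two i j r -> two k l s ->
  small (r * s) \/ i = k /\ j = l \/ i = l /\ j = k.
Proof.
move=> tr ts; apply: contrapT => /not_orP[ns n]; apply: ns.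
(* Two distinct common points would make the unordered pairs equal. *)
have {}n a b : a <> b -> (a = i \/ a = j) -> (b = i \/ b = j) ->
   (a = k \/ a = l) -> (b = k \/ b = l) -> False.
  by move=> ab h1 h2 h3 h4; apply: n; cases; subst; tauto.
have pr := two_partial_injection tr.
have ps := two_partial_injection ts.
have supp_r a b : r (a, b) -> b = i \/ b = j.
  by case: tr => ->; rewrite /swap /pair_id /=; intuition (subst; auto).
have supp_s a b : s (a, b) -> a = k \/ a = l.
  by case: ts => ->; rewrite /swap /pair_id /=; intuition (subst; auto).
move=> [a b] [c d] [/= x rax sxb] [y /= rcy syd].
have [xy|nxy] := pselect (x = y); last first.
  by case: (n x y nxy); eauto.
by congr pair; [apply/(pr _ _ _ _ rax rcy)|apply/(ps _ _ _ _ sxb syd)].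
Qed.

Lemma rigid_mul r s : rigid r -> rigid s -> rigid (r * s).
Proof.
move=> hr hs.
have pr := rigid_partial_injection hr; have ps := rigid_partial_injection hs.
case: (hr) => [->|sr|[i [j [nij tr]]]]; first by rewrite equality_mul.
  by apply: Or32; apply: small_mulr.
case: (hs) => [->|ss|[k [l [nkl ts]]]].
- by rewrite mul_equality; apply: Or33; exists i, j.
- by apply: Or32; apply: small_mull.
have [?|e] := two_mul_diff tr ts; first exact: Or32.
apply: Or33; exists i, j; split=> //; apply: two_mul_same => //.
by case: e => -[-> ->] //; apply: two_sym.
Qed.

Lemma two_not_small i j r : i <> j -> two i j r -> ~ small r.
Proof.
move=> nij [] -> sr.
- by have [] : (i, j) = (j, i) by apply: sr => /=; tauto.
- by have [] : (i, i) = (j, j) by apply: sr => /=; tauto.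
Qed.

Lemma pair_id_inj i j k l : i <> j -> pair_id i j = pair_id k l ->
  i = k /\ j = l \/ i = l /\ j = k.
Proof.
move=> nij e.
have : pair_id k l (i, i) by rewrite -e /pair_id /=; tauto.
have : pair_id k l (j, j) by rewrite -e /pair_id /=; tauto.
rewrite /pair_id /= => h1 h2; cases; subst; tauto.
Qed.

Lemma pair_idC i j : pair_id i j = pair_id j i.
Proof. by apply: rel_eqP => a b /=; tauto. Qed.

Lemma swap_sqr i j : swap i j * swap i j = pair_id i j.
Proof.
apply: rel_eqP => a b; rewrite mulrelE /swap /pair_id /=.
split=> [[c h h']|h]; first by cases; subst; tauto.
by cases; subst; [exists j|exists i]; tauto.
Qed.

Lemma pair_id_mulE i j r a b :
  (pair_id i j * r)%g (a, b) <-> r (a, b) /\ (a = i \/ a = j).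
Proof. by split=> [[c [/= -> ?]]|[? ?]] //; exists a. Qed.

Lemma pair_id_sqr i j : pair_id i j * pair_id i j = pair_id i j.
Proof. by apply: rel_eqP => a b; rewrite pair_id_mulE /=; tauto. Qed.

Lemma pair_id_swap i j : pair_id i j * swap i j = swap i j.
Proof. by apply: rel_eqP => a b; rewrite pair_id_mulE /=; tauto. Qed.

Lemma swap_pair_id i j : swap i j * pair_id i j = swap i j.
Proof. by rewrite -[in LHS]swap_sqr mulgA swap_sqr pair_id_swap. Qed.

Lemma swap_neq_pair_id i j k l : i <> j -> swap i j <> pair_id k l.
Proof.
move=> nij e; have : pair_id k l (i, j) by rewrite -e /swap /=; tauto.
by case.
Qed.

Lemma single_mul i j k : single i j * single j k = single i k.
Proof.
apply: rel_eqP => a b; rewrite mulrelE /single /=; split=> [[c]|]; first tauto.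
by exists j; tauto.
Qed.

Lemma single_mul0 i j k l : j <> k -> single i j * single k l = set0.
Proof.
move=> njk; apply: rel_eqP => a b; rewrite mulrelE /single /=; split=> // -[c].
by case=> _ -> [/njk].
Qed.

Lemma single_inj i j k l : single i j = single k l -> i = k /\ j = l.
Proof. by move=> e; have : single k l (i, j) by rewrite -e. Qed.

Lemma single_neq0 i j : single i j <> set0.
Proof. by move=> e; have : set0 (i, j) by rewrite -e. Qed.

(** * Generation of the rigid relations over at least three points *)

Variables i0 i1 i2 : I.
Hypotheses (n01 : i0 <> i1) (n02 : i0 <> i2) (n12 : i1 <> i2).

Lemma third i j : exists k, k <> i /\ k <> j.
Proof.
have [a0|a0] := pselect (i0 = i \/ i0 = j); last by exists i0; tauto.
have [a1|a1] := pselect (i1 = i \/ i1 = j); last by exists i1; tauto.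
by exists i2; split=> e; subst; case: a0; case: a1; congruence.
Qed.

Lemma two_neq_equality i j r : two i j r -> r <> equality_rel.
Proof.
move=> tr e; have [k [ki kj]] := third i j.
have : r (k, k) by rewrite e.
by case: tr => ->; rewrite /swap /pair_id /=; tauto.
Qed.

Lemma small_neq_equality r : small r -> r <> equality_rel.
Proof.
by move=> sr e; have [] : (i0, i0) = (i1, i1) by apply: sr; rewrite e.
Qed.

(** Two swaps sharing exactly one point compose to an off-diagonal singleton; the third point makes
    every such singleton available. Two of these give the diagonal singletons, two different
    diagonal singletons give the empty relation, and the square of a swap is [pair_id]. *)
Lemma rigid_eq_generated : [set r | rigid r] = generated swap_generators.
Proof.
apply/seteqP; split=> [r rr B [[_ sB] gB]|]; last first.
  apply: smallest_sub; first split.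
  - by exists equality_rel; apply: Or31.
  - by move=> _ [r rr [s ss <-]]; apply: rigid_mul.
  - move=> r [->|[i [j [nij ->]]]]; first exact: Or31.
    by apply: Or33; exists i, j; split=> //; left.
have mB s t : B s -> B t -> B (s * t).
  by move=> Bs Bt; apply: sB; exists s => //; exists t.
have swB i j : i <> j -> B (swap i j).
  by move=> nij; apply: gB; right; exists i, j.
have ptB i k : i <> k -> B (single i k).
  move=> nik; have [j [ji jk]] := third i k.
  suff <- : swap i j * swap j k = single i k.
    by apply: mB; apply: swB => //; exact/nesym.
  apply: rel_eqP => a b; rewrite mulrelE /swap /single /=; split=> [[c h h']|h].
    by cases; subst; tauto.
  by exists j; tauto.
have ptB' i k : B (single i k).
  have [->|/ptB//] := pselect (i = k).
  have [j [ji _]] := third k k.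
  by rewrite -(single_mul k j k); apply: mB; apply: ptB => //; exact/nesym.
case: rr => [->|/smallP[->|[i [j ->]]]//|[i [j [nij [] ->]]]].
- by apply: gB; left.
- by rewrite -(@single_mul0 i0 i0 i1 i1 n01); apply: mB.
- exact: swB.
- by rewrite -swap_sqr; apply: mB; exact: swB.
Qed.

End Relations.

(** * Strongly rigid pseudometrics *)

Lemma generated_subsemigroup (S : semigroupType) (A : set S) :
  A !=set0 -> subsemigroup (generated A).
Proof.
move=> [a Aa]; split; first by exists a; apply: sub_gen_smallest.
move=> _ [x gx [y gy <-]] B AB; have [[_ sB] _] := AB.
by apply: sB; exists x; [exact: gx|exists y => //; exact: gy].
Qed.

Lemma generated_image (S T : semigroupType) (f : S -> T) (A : set S) :
  A !=set0 -> (forall x y, f (x * y) = f x * f y) ->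
  generated (f @` A) = f @` generated A.
Proof.
move=> A0 fM; have [gA0 gA] := generated_subsemigroup A0.
have [_ gfA] := generated_subsemigroup (image_nonempty f A0).
apply/seteqP; split.
  apply: smallest_sub; last by apply: image_subset; apply: sub_gen_smallest.
  split; first exact: image_nonempty.
  move=> _ [_ [x gx <-] [_ [y gy <-] <-]]; exists (x * y); last exact: fM.
  by apply: gA; exists x => //; exists y.
move=> _ [x gx <-]; pose B := f @^-1` generated (f @` A).
suff : generated A `<=` B by apply.
apply: smallest_sub; last first.
  by move=> a Aa; apply: sub_gen_smallest; exists a.
split; first by case: A0 => a Aa; exists a; apply: sub_gen_smallest; exists a.
move=> _ [y By [z Bz <-]]; rewrite /B /= fM; apply: gfA.
by exists (f y) => //; exists (f z).
Qed.

(** * Comparing cardinals with 2, 3 and the continuum *)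

Lemma subset2_card_le_II (T : Type) (A : set T) (a b : T) :
  A `<=` [set a; b] -> A #<= `I_2.
Proof.
move=> /subset_card_le; move/card_le_trans; apply.
pose h (n : nat) := if n is 0%N then a else b.
have <- : h @` `I_2 = [set a; b]; last exact: card_image_le.
apply/seteqP; split=> [_ [[|n] _ <-]|_ [->|->]]; [by left|by right| |].
  by exists 0%N.
by exists 1%N.
Qed.

Lemma II3_card_le (T : Type) (A : set T) (a b c : T) :
  A a -> A b -> A c -> a <> b -> a <> c -> b <> c -> `I_3 #<= A.
Proof.
move=> Aa Ab Ac ab ac bc.
pose h (n : nat) := match n with 0%N => a | 1%N => b | _ => c end.
have hA : h @` `I_3 `<=` A by move=> _ [[|[|n]] _ <-].
apply: card_le_trans (subset_card_le hA).
have hI : {in `I_3 &, injective h}.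
  move=> [|[|[|?]]] [|[|[|?]]] /[!inE] // _ _ /= e; exfalso; congruence.
by rewrite (card_le_eqr (inj_card_eq hI)).
Qed.

Lemma II2_card_le (T : Type) (A : set T) (a b : T) :
  A a -> A b -> a <> b -> `I_2 #<= A.
Proof.
move=> Aa Ab ab.
pose h (n : nat) := match n with 0%N => a | _ => b end.
have hA : h @` `I_2 `<=` A by move=> _ [[|n] _ <-].
apply: card_le_trans (subset_card_le hA).
have hI : {in `I_2 &, injective h}.
  move=> [|[|?]] [|[|?]] /[!inE] // _ _ /= e; exfalso; congruence.
by rewrite (card_le_eqr (inj_card_eq hI)).
Qed.

Lemma card_le_setTP (T U : Type) :
  [set: T] #<= [set: U] <-> exists f : T -> U, injective f.
Proof.
split=> [/card_leP[f]|[f fI]].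
  have inT t : t \in [set: T] by rewrite inE.
  exists (fun t => val (f (SigSub (inT t)))) => s t /val_inj.
  by move=> /(@inj _ _ _ f)-/(_ (mem_setT _) (mem_setT _))/(congr1 val).
have h : {in [set: T] &, injective f} by move=> s t _ _; exact: fI.
by rewrite -(card_le_eql (inj_card_eq h)); exact: card_leT.
Qed.

(** An injection of the two-element subsets of [I] into [R], written as a function of two arguments;
    its values on the diagonal are unconstrained. *)
Definition pair_labelling (R I : Type) (g : I -> I -> R) : Prop :=
  (forall i j, i <> j -> g i j = g j i) /\
  forall i j k l, i <> j -> k <> l -> g i j = g k l ->
    i = k /\ j = l \/ i = l /\ j = k.

(** The condition through which both directions of the equivalence pass. [R] is a bare type because
    only its cardinality counts here. *)
Definition rigid_representable (R : Type) (H : semigroupType) : Prop :=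
  exists (I : Type) (i0 i1 i2 : I) (g : I -> I -> R),
    [/\ i0 <> i1, i0 <> i2, i1 <> i2, pair_labelling g
      & isomorphic [set: H] [set r : binrel I | rigid r]].

(** * Lifting relations along a surjection *)

Definition pullback (X I : Type) (q : X -> I) (r : binrel I) : binrel X :=
  fun p => r (q p.1, q p.2).

Section Pullback.
Variables (X I : Type) (q : X -> I).
Hypothesis q_surj : forall i, exists x, q x = i.

(** Surjectivity supplies a point of [X] above the intermediate point of [I]. *)
Lemma pullback_mul (r s : binrel I) :
  pullback q (r * s) = pullback q r * pullback q s.
Proof.
apply: rel_eqP => x y; split=> [[i rxi siy]|[z rxz szy]]; last by exists (q z).
by have [z zi] := q_surj i; exists z; rewrite /pullback /= zi.
Qed.

Lemma pullback_inj : injective (pullback q).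
Proof.
move=> r s e; apply: rel_eqP => i j.
have [x <-] := q_surj i; have [y <-] := q_surj j.
by rewrite -/(pullback q r (x, y)) e.
Qed.

End Pullback.

(** * From a strongly rigid pseudometric to rigid relations on its quotient *)

Section RigidPseudometric.
Variables (R : realType) (X I : Type) (d : X * X -> R) (q : X -> I).
Hypothesis q_surj : forall i, exists x, q x = i.
Hypothesis d_pm : pseudometric d.
Hypothesis q_eq : forall x y, q x = q y <-> d (x, y) = 0%R.
Hypothesis d_rigid : strongly_rigid d.

(** Moving one endpoint at a time by distance 0 leaves the distance unchanged, by triangle
    inequalities in both directions. *)
Lemma pseudometric_congr x y u v :
  q x = q u -> q y = q v -> d (x, y) = d (u, v).
Proof.
have [d0 dC _ dT] := d_pm.
move=> /q_eq xu /q_eq yv.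
have := dT x u y; have := dT u v y; have := dT u x v; have := dT x y v.
rewrite (dC u x) (dC v y) xu yv; lra.
Qed.

Lemma pseudometric_pair_inj x y u v : q x <> q y -> d (x, y) = d (u, v) ->
  q x = q u /\ q y = q v \/ q x = q v /\ q y = q u.
Proof.
move=> nxy e; have n0 : d (u, v) <> 0%R by rewrite -e => /q_eq.
by have := d_rigid e n0; rewrite -!q_eq.
Qed.

(** The fiber over 0 is equality of classes. By strong rigidity a nonzero distance is attained on
    one unordered pair of classes only, so its fiber is the lift of a swap. *)
Lemma fibers_pullback : [set: X] !=set0 ->
  fibers d = pullback q @` (@swap_generators I : set (binrel I)).
Proof.
have [d0 dC dxx dT] := d_pm.
have swapE x y : q x <> q y ->
    d @^-1` [set d (x, y)] = pullback q (swap (q x) (q y)).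
  move=> nxy; apply: rel_eqP => u v; split.
    move=> /= /esym/(pseudometric_pair_inj nxy).
    by rewrite /pullback /= => -[[-> ->]|[-> ->]]; [left|right].
  by case=> /= -[/pseudometric_congr h /h e]; rewrite /= e // dC.
have eqE : d @^-1` [set 0%R] = pullback q (@equality_rel I).
  by apply: rel_eqP => u v; symmetry; exact: q_eq.
move=> [x0 _]; apply/seteqP; split=> [_ [_ [[x y] _ <-] <-]|_ [r + <-]].
  have [/q_eq xy|nxy] := pselect (q x = q y).
    by rewrite xy eqE; exists (@equality_rel I) => //; left.
  rewrite swapE //; exists (swap (q x) (q y)) => //.
  by right; exists (q x), (q y).
move=> [->|[i [j [nij ->]]]].
  by exists 0%R; [exists (x0, x0)|rewrite eqE].
have [x xi] := q_surj i; have [y yj] := q_surj j; subst.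
by exists (d (x, y)); [exists (x, y)|rewrite swapE].
Qed.

(** With at most two classes, the only possible distances are 0 and the distance between the two
    classes. *)
Lemma nondiscrete_three : [set: X] !=set0 ->
  ~ discrete_pseudometric d ->
  exists i0 i1 i2 : I, [/\ i0 <> i1, i0 <> i2 & i1 <> i2].
Proof.
move=> [x0 _] nd; apply: contrapT => n3; apply: nd.
have [d0 dC dxx dT] := d_pm.
have [[x [y nxy]]|n2] := pselect (exists x y, q x <> q y); last first.
  apply: (@subset2_card_le_II _ _ 0%R 0%R) => _ [[x y] _ <-]; left.
  by apply/q_eq; apply: contrapT => ?; apply: n2; exists x, y.
apply: (@subset2_card_le_II _ _ 0%R (d (x, y))) => _ [[u v] _ <-].
have [/q_eq ->|nuv] := pselect (q u = q v); [by left|right].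
have third w : q w = q x \/ q w = q y.
  apply: contrapT => /not_orP[wx wy]; apply: n3.
  by exists (q x), (q y), (q w); split=> //; exact/nesym.
case: (third u) => eu; case: (third v) => ev; try congruence.
- exact: pseudometric_congr.
- by rewrite dC; exact: pseudometric_congr.
Qed.

Lemma pseudometric_rigid_representable (H : semigroupType) :
  [set: X] !=set0 -> ~ discrete_pseudometric d ->
  isomorphic [set: H] (generated (fibers d : set (binrel X))) ->
  rigid_representable R H.
Proof.
move=> X0 nd [f [fG fI fS] fM].
have [i0 [i1 [i2 [n01 n02 n12]]]] := nondiscrete_three X0 nd.
have [d0 dC dxx dT] := d_pm.
have [rep repP] := choice q_surj.
(* A pair of classes is labelled by the distance between chosen representatives. *)
exists I, i0, i1, i2, (fun i j => d (rep i, rep j)); split=> //.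
  split=> [i j _|i j k l nij nkl /pseudometric_pair_inj]; first exact: dC.
  by rewrite !repP; apply.
have gensN0 : (@swap_generators I) !=set0 by exists (@equality_rel I); left.
have gE : generated (fibers d : set (binrel X)) =
    pullback q @` [set r | rigid r].
  rewrite fibers_pullback // generated_image //; last exact: pullback_mul.
  by rewrite (rigid_eq_generated n01 n02 n12).
(* The representation is the given isomorphism followed by the inverse of the injective map
   [pullback q]. *)
have /choice[h hP] x : exists r, rigid r /\ pullback q r = f x.
  have := fG x Logic.I; rewrite gE => -[r rr <-].
  by exists r.
exists h.
  split=> [x _|x y _ _ e|r rr]; first by have [] := hP x.
    apply: fI; rewrite ?inE //.
    by rewrite -(hP x).2 -(hP y).2 e.
  have [|x _ fx] := fS (pullback q r); first by rewrite gE; exists r.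
  by exists x => //; apply: (pullback_inj q_surj); rewrite (hP x).2.
move=> x y _ _; apply: (pullback_inj q_surj).
by rewrite (hP _).2 pullback_mul // !(hP _).2 fM.
Qed.

End RigidPseudometric.

Lemma rigid_pseudometric_representable (R : realType) (H : semigroupType)
    (X : Type) (d : X * X -> R) :
  [set: X] !=set0 -> pseudometric d -> ~ discrete_pseudometric d ->
  strongly_rigid d ->
  isomorphic [set: H] (generated (fibers d : set (binrel X))) ->
  rigid_representable R H.
Proof.
move=> X0 dpm nd dr iso; have [d0 dC dxx dT] := dpm.
(* The quotient is the type of those subsets of [X] that are classes of points at distance 0. *)
pose cls x : set X := [set y | d (x, y) = 0%R].
pose q x : {A : set X | exists x, A = cls x} :=
  exist _ (cls x) (ex_intro _ x erefl).
apply: (pseudometric_rigid_representable (q := q) _ _ _ _ X0 nd iso) => //.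
- by move=> [A [x Ax]]; exists x; exact/eq_exist.
- move=> x y; split=> [[e]|xy].
    by have : cls y y; [exact: dxx|rewrite -e].
  apply/eq_exist/seteqP; split=> z; rewrite /cls /= => e.
    by have := dT y x z; have := d0 y z; rewrite (dC y x); lra.
  by have := dT x y z; have := d0 x z; lra.
Qed.

(** * A strongly rigid metric from a labelling of pairs *)

Section Metric.
Import Order.TTheory GRing.Theory Num.Theory.
Variables (R : realType) (I : Type) (g : I -> I -> R).
Hypothesis g_lab : pair_labelling g.
Local Open Scope ring_scope.

(* [x / (1 + |x|)] squeezes the labels into (-1, 1), so that all distances
   between distinct points lie in (1, 2) and the triangle inequality is
   automatic. *)
Let h (x : R) : R := (3 + x / (1 + `|x|)) / 2.

Let h_bounds x : 1 < h x < 2.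
Proof.
have p : 0 < 1 + `|x| by have := normr_ge0 x; lra.
have hh : -1 < x / (1 + `|x|) < 1.
  rewrite ltr_pdivlMr // ltr_pdivrMr //.
  have := ler_norm x; have := ler_norm (- x); rewrite normrN; lra.
by rewrite /h; lra.
Qed.

Let h_inj : injective h.
Proof.
move=> x y; rewrite /h => e.
have {e} : x / (1 + `|x|) = y / (1 + `|y|) by lra.
have px : 0 < 1 + `|x| by have := normr_ge0 x; lra.
have py : 0 < 1 + `|y| by have := normr_ge0 y; lra.
move/eqP; rewrite eqr_div ?lt0r_neq0 // => /eqP.
have := normr_ge0 x; have := normr_ge0 y.
(* After cross-multiplication, equal signs make the terms in [x * y] cancel. For opposite signs,
   [x - y] is twice [x * y] up to sign, and since [x * y] is nonpositive this contradicts the order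
   of [x] and [y]. *)
case: (ger0P x) => hx; case: (ger0P y) => hy _ _ e.
- by lra.
- by have := mulr_ge0_le0 hx (ltW hy); lra.
- by have := mulr_le0_ge0 (ltW hx) hy; lra.
- by lra.
Qed.

Definition label_metric (p : I * I) : R :=
  if pselect (p.1 = p.2) then 0 else h (g p.1 p.2).

Let dE0 i : label_metric (i, i) = 0.
Proof. by rewrite /label_metric /=; case: pselect. Qed.

Let dE i j : i <> j -> label_metric (i, j) = h (g i j).
Proof. by rewrite /label_metric /=; case: pselect. Qed.

Let d_bounds i j : i <> j -> 1 < label_metric (i, j) < 2.
Proof. by move=> nij; rewrite dE. Qed.

Lemma label_metric_eq0 i j : i = j <-> label_metric (i, j) = 0.
Proof.
split=> [->//|e]; apply: contrapT => /d_bounds; rewrite e; lra.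
Qed.

Lemma label_metric_pseudometric : pseudometric label_metric.
Proof.
have ge0 i j : 0 <= label_metric (i, j).
  by have [->|/d_bounds] := pselect (i = j); rewrite ?dE0 //; lra.
split=> // [i j|i j k].
  have [->//|nij] := pselect (i = j).
  by have nji := nesym nij; rewrite !dE // (g_lab.1 _ _ nij).
have [->|nij] := pselect (i = j); first by rewrite dE0; lra.
have [->|njk] := pselect (j = k); first by rewrite dE0; lra.
have := d_bounds nij; have := d_bounds njk.
by have [->|/d_bounds] := pselect (i = k); rewrite ?dE0; lra.
Qed.

Lemma label_metric_inj i j k l : i <> j -> k <> l ->
  label_metric (i, j) = label_metric (k, l) ->
  i = k /\ j = l \/ i = l /\ j = k.
Proof. by move=> nij nkl; rewrite !dE // => /h_inj; exact: g_lab.2. Qed.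

Lemma label_metric_strongly_rigid : strongly_rigid label_metric.
Proof.
move=> x y u v e /label_metric_eq0 nuv.
have nxy : x <> y by move/label_metric_eq0; rewrite e => /label_metric_eq0.
by rewrite -!label_metric_eq0; exact: label_metric_inj.
Qed.

End Metric.

Lemma representable_rigid_pseudometric (R : realType) (H : semigroupType) :
  rigid_representable R H ->
  exists (X : Type) (d : X * X -> R),
    [/\ [set: X] !=set0, pseudometric d, ~ discrete_pseudometric d,
        strongly_rigid d
      & isomorphic [set: H] (generated (fibers d : set (binrel X)))].
Proof.
move=> [I [i0 [i1 [i2 [g [n01 n02 n12 gl iso]]]]]].
pose d := label_metric g; have d_pm := label_metric_pseudometric gl.
have dr := label_metric_strongly_rigid gl.
have I0 : [set: I] !=set0 by exists i0.
exists I, d; split=> //.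
  move=> dd; suff : `I_3 #<= `I_2 by rewrite card_le_II.
  apply: card_le_trans dd.
  (* Three points already give three different distances. *)
  apply: (@II3_card_le _ _ 0%R (d (i0, i1)) (d (i0, i2))).
  - by exists (i0, i0) => //; have [h _] := label_metric_eq0 g i0 i0; exact: h.
  - by exists (i0, i1).
  - by exists (i0, i2).
  - by move=> /esym/(label_metric_eq0 g).
  - by move=> /esym/(label_metric_eq0 g).
  - by move/(label_metric_inj gl n01 n02) => [[_]|[]].
(* Distinct points have nonzero distance, so the quotient map is the identity and lifting changes
   nothing. *)
have idS (i : I) : exists x, id x = i by exists i.
rewrite (fibers_pullback idS d_pm (fun x y => label_metric_eq0 g x y) dr I0).
have -> : @pullback I I id = id.
  by apply: funext => r; apply: rel_eqP.
by rewrite image_id -(rigid_eq_generated n01 n02 n12).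
Qed.

(** * The band structure of the rigid relations *)

Section BandStructure.
Variables (I : Type) (i0 i1 i2 : I).
Hypotheses (n01 : i0 <> i1) (n02 : i0 <> i2) (n12 : i1 <> i2).
Variables (H : semigroupType) (rho : H -> binrel I) (elt : binrel I -> H).
Hypothesis rho_rigid : forall x, rigid (rho x).
Hypothesis rho_inj : injective rho.
Hypothesis rho_mul : forall x y, rho (x * y) = rho x * rho y.
Hypothesis eltK : forall r, rigid r -> rho (elt r) = r.

Implicit Types (i j k l : I) (r : binrel I) (x y e : H).

Definition hat : set H := [set x | rho x <> @equality_rel I].
Definition core : set H := [set x | small (rho x)].
Let theta : H := elt set0.
Let pt (i j : I) : H := elt (single i j).
(** This set plays the part of Omega: each block is indexed by its own identity element. *)
Definition noncore_idempotents : set H := idempotents hat `\` core.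
(** In a group of order 2 every square is the identity, so the square of an element names its
    block. *)
Definition block (e : {e | noncore_idempotents e}) : set H :=
  [set x | (hat `\` core) x /\ x * x = sval e].

Let rho_theta : rho theta = set0.
Proof. by apply: eltK; exact: Or32. Qed.

Let rho_pt i j : rho (pt i j) = single i j.
Proof. by apply: eltK; apply: Or32; exact: small_single. Qed.

Let rho_two i j r : i <> j -> two i j r -> rho (elt r) = r.
Proof. by move=> nij tr; apply: eltK; apply: Or33; exists i, j. Qed.

Let rho_unit : rho (elt (@equality_rel I)) = @equality_rel I.
Proof. by apply: eltK; exact: Or31. Qed.

Let two_swap i j : two i j (swap i j). Proof. by left. Qed.
Let two_pair_id i j : two i j (pair_id i j). Proof. by right. Qed.

Let rho_pi x : partial_injection (rho x).
Proof. exact: rigid_partial_injection. Qed.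

Let core_hat : core `<=` hat.
Proof. by move=> x; apply: small_neq_equality n01 _. Qed.

Let two_hat i j x : two i j (rho x) -> hat x.
Proof. exact: (two_neq_equality n01 n02 n12). Qed.

(** If (i,j) factors through k inside the same partial injection, then k = j since it is a function
    and i = k since it is injective. Idempotents are thus the subrelations of equality. *)
Lemma idempotent_subE x : x * x = x <-> forall i j, rho x (i, j) -> i = j.
Proof.
split=> [xx i j|h].
  move=> xij; have [k /= xik xkj] : (rho x * rho x)%g (i, j).
    by rewrite -rho_mul xx.
  have kj : k = j by apply/(rho_pi xik xij).
  by rewrite -[RHS]kj; apply/(rho_pi xij xkj).
apply: rho_inj; rewrite rho_mul; apply: rel_eqP => i j.
split=> [[k /= /[dup]/h -> //]|xij].
by exists i => //=; have := xij; rewrite -(h _ _ xij).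
Qed.

Lemma hat_cases x : hat x -> core x \/ exists i j, i <> j /\ two i j (rho x).
Proof. by move=> hx; case: (rho_rigid x) => // ?; [left|right]. Qed.

Lemma core_cases x : core x -> x = theta \/ exists i j, x = pt i j.
Proof.
case/smallP => [e|[i [j e]]]; [left|right; exists i, j];
  by apply: rho_inj; rewrite e ?rho_theta ?rho_pt.
Qed.

Let core_theta : core theta.
Proof. by rewrite /core /= rho_theta; exact: small_set0. Qed.

Let core_pt i j : core (pt i j).
Proof. by rewrite /core /= rho_pt; exact: small_single. Qed.

Let theta_mul x : theta * x = theta.
Proof.
apply: rho_inj; rewrite rho_mul rho_theta.
by apply: rel_eqP => i j; split=> // -[].
Qed.

Let mul_theta x : x * theta = theta.
Proof.
apply: rho_inj; rewrite rho_mul rho_theta.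
by apply: rel_eqP => i j; split=> // -[].
Qed.

Let pt_mul i j k : pt i j * pt j k = pt i k.
Proof. by apply: rho_inj; rewrite rho_mul !rho_pt single_mul. Qed.

Let pt_mul0 i j k l : j <> k -> pt i j * pt k l = theta.
Proof.
by move=> njk; apply: rho_inj; rewrite rho_mul !rho_pt single_mul0 ?rho_theta.
Qed.

Let pt_inj i j k l : pt i j = pt k l -> i = k /\ j = l.
Proof. by move=> /(congr1 rho); rewrite !rho_pt; exact: single_inj. Qed.

Let pt_neq_theta i j : pt i j <> theta.
Proof.
by move=> /(congr1 rho); rewrite rho_pt rho_theta; exact: single_neq0.
Qed.

Lemma core_mulr x y : core x -> core (x * y).
Proof.
by move=> cx; rewrite /core /= rho_mul; apply: small_mulr.
Qed.

Lemma core_mull x y : core y -> core (x * y).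
Proof.
by move=> cx; rewrite /core /= rho_mul; apply: small_mull.
Qed.

Lemma hat_mul x y : hat x -> hat y -> hat (x * y).
Proof.
move=> /hat_cases[cx|[i [j [nij tx]]]].
  by move=> _; apply/core_hat/core_mulr.
move=> /hat_cases[cy|[k [l [nkl ty]]]]; first by apply/core_hat/core_mull.
have [sxy|ijkl] := two_mul_diff tx ty.
  by apply: core_hat; rewrite /core /= rho_mul.
apply: (@two_hat i j); rewrite rho_mul; apply: two_mul_same => //.
by case: ijkl => -[-> ->] //; exact: two_sym.
Qed.

Lemma noncore_idempotentP e : noncore_idempotents e <->
  exists i j, i <> j /\ rho e = pair_id i j.
Proof.
split=> [[[he ee] nce]|[i [j [nij ep]]]].
  case: (hat_cases he) => // -[i [j [nij [] ep]]]; exists i, j; split=> //.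
  case: nij; move/idempotent_subE: ee; apply; rewrite ep /=; tauto.
have te : two i j (rho e) by right.
split; last exact: two_not_small te.
split; first exact: two_hat te.
by apply/idempotent_subE => k l; rewrite ep /= => -[].
Qed.

Lemma block_rho i j (e : {e | noncore_idempotents e}) : i <> j ->
  rho (sval e) = pair_id i j -> forall x, block e x <-> two i j (rho x).
Proof.
move=> nij ep x; split=> [[[hx ncx] xx]|tx].
  case: (hat_cases hx) => // -[k [l [nkl tx]]].
  have xx2 : rho (x * x) = pair_id k l.
    rewrite rho_mul; case: tx => ->; first exact: swap_sqr.
    exact: pair_id_sqr.
  have : pair_id i j = pair_id k l by rewrite -ep -xx.
  by case/(pair_id_inj nij) => -[-> ->] //; exact: two_sym.
split; first by split; [exact: two_hat tx|exact: two_not_small tx].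
apply: rho_inj; rewrite rho_mul ep; case: tx => ->; first exact: swap_sqr.
exact: pair_id_sqr.
Qed.

Let block_spec (e : {e | noncore_idempotents e}) :
  exists i j, [/\ i <> j, rho (sval e) = pair_id i j &
    forall x, block e x <-> two i j (rho x)].
Proof.
have /noncore_idempotentP[i [j [nij ep]]] := svalP e.
by exists i, j; split=> //; exact: block_rho.
Qed.

Let block_pair (e : {e | noncore_idempotents e}) :
  exists2 s, s <> sval e &
   [/\ block e = [set sval e; s], s * s = sval e, sval e * s = s,
       s * sval e = s & sval e * sval e = sval e].
Proof.
have [i [j [nij ep bE]]] := block_spec e.
have rs := rho_two nij (two_swap i j).
have pi_swap : pair_id i j * swap i j = swap i j :> binrel I.
  exact: pair_id_swap.
have swap_pi : swap i j * pair_id i j = swap i j :> binrel I.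
  exact: swap_pair_id.
exists (elt (swap i j)).
  by move/(congr1 rho); rewrite rs ep; exact: swap_neq_pair_id.
split; last by have [[_ ee] _] := svalP e; exact: ee.
- apply/seteqP; split=> x.
    by move/bE => -[] rx; [right|left]; apply: rho_inj; rewrite rx ?rs ?ep.
  by case=> ->; apply/bE; rewrite ?rs ?ep; [right|left].
- by apply: rho_inj; rewrite rho_mul rs swap_sqr ep.
- by apply: rho_inj; rewrite rho_mul rs ep ?pair_id_swap ?swap_pair_id.
- by apply: rho_inj; rewrite rho_mul rs ep ?pair_id_swap ?swap_pair_id.
Qed.

Let third_index i : exists j, j <> i.
Proof. by have [j []] := third n01 n02 n12 i i; exists j. Qed.

Lemma core_subsemigroup : subsemigroup core.
Proof.
by split; [exists theta|move=> _ [x cx [y cy <-]]; exact: core_mulr].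
Qed.

Lemma hat_subsemigroup : subsemigroup hat.
Proof.
split; first by exists theta; exact: core_hat.
by move=> _ [x hx [y hy <-]]; exact: hat_mul.
Qed.

Lemma hat_band_with_core : band_with_core hat block core.
Proof.
split.
- split; [exact: core_subsemigroup|exact: core_hat| |].
    by move=> _ [x cx [y _ <-]]; exact: core_mulr.
  by move=> _ [x _ [y cy <-]]; exact: core_mull.
(* The core is proper: it misses the element representing a swap. *)
- move=> ch; have t := two_swap i0 i1; apply: (two_not_small n01 t).
  rewrite -(rho_two n01 t); suff : core (elt (swap i0 i1)) by [].
  by rewrite ch; apply: (@two_hat i0 i1); rewrite (rho_two n01 t).
- split; last by move=> e _; have [s _ [-> _ _ _ _]] := block_pair e;
    exists (sval e); left.
    apply/seteqP; split=> [x [e _ []]//|x [hx ncx]].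
    case: (hat_cases hx) => // -[i [j [nij tx]]].
    have ne : noncore_idempotents (elt (pair_id i j)).
      by apply/noncore_idempotentP; exists i, j; split=> //;
        rewrite (rho_two nij (two_pair_id i j)).
    exists (exist _ _ ne) => //; apply/(block_rho nij) => //=.
    by rewrite (rho_two nij (two_pair_id i j)).
  (* Blocks are disjoint because the square of a common element is both indices. *)
  by move=> e f _ _ [x [[_ xe] [_ xf]]]; apply: eq_sig_hprop => [? ? ?|];
    [exact: Prop_irrelevance|rewrite -xe].
- move=> e; have [s _ [bE ss es se ee]] := block_pair e.
  split; first by exists (sval e); rewrite bE; left.
  rewrite bE => _ [x [->|->] [y [->|->] <-]];
    rewrite ?ss ?es ?se ?ee; by [left|right].
(* By [two_mul_diff] a product outside the core forces equal pairs, hence equal indices. *)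
- move=> e f nef _ [x xe [y yf <-]].
  have [i [j [nij ep be]]] := block_spec e.
  have [k [l [nkl fp bf]]] := block_spec f.
  move/be: xe => tx; move/bf: yf => ty.
  have [sxy|ijkl] := two_mul_diff tx ty; first by rewrite /core /= rho_mul.
  case: nef; apply: eq_sig_hprop => [? ? ?|]; first exact: Prop_irrelevance.
  apply: rho_inj; rewrite ep fp.
  by case: ijkl => -[-> ->] //; exact: pair_idC.
Qed.

Lemma block_group (e : {e | noncore_idempotents e}) :
  is_group (block e) /\ block e #= `I_2.
Proof.
have [s nse [bE ss es se ee]] := block_pair e.
split; last first.
  apply/card_eqPle; split.
    by apply: (@subset2_card_le_II _ _ (sval e) s); rewrite bE.
  apply: (@II2_card_le _ _ (sval e) s); rewrite ?bE; [by left|by right|].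
  exact/nesym.
split; first by have [_ _ _ + _] := hat_band_with_core; apply.
exists (sval e).
  by split; rewrite bE; [left|move=> x [->|->]].
by rewrite bE => x [->|->]; [exists (sval e) => //; left|exists s => //; right].
Qed.

(** * The core and the class H_1 *)

Lemma core_idempotents x :
  idempotents core x <-> x = theta \/ exists i, x = pt i i.
Proof.
split=> [[cx /idempotent_subE xx]|[->|[i ->]]].
- case: (core_cases cx) xx => [->|[i [j ->]]]; first by left.
  by rewrite rho_pt => /(_ i j) /= <- //; right; exists i.
- by split; [exact: core_theta|exact: theta_mul].
- by split; [exact: core_pt|exact: pt_mul].
Qed.

Lemma core_zero : is_zero core theta.
Proof.
split=> //.
by apply: (@II2_card_le _ _ theta (pt i0 i0)) => //; exact/nesym/pt_neq_theta.
Qed.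

Lemma core_nontrivial_idempotents x :
  nontrivial_idempotent core x <-> exists i, x = pt i i.
Proof.
split=> [[/core_idempotents[->|//] nz _]|[i ->]].
  by case: nz; exact: core_zero.
split.
- by apply/core_idempotents; right; exists i.
- case=> _ _ /(_ _ core_theta) [+ _]; rewrite mul_theta.
  by move/esym/pt_neq_theta.
(* [pt i i] annihilates [pt j j] for another index j, so it is no identity of the core. *)
- have [j nji] := third_index i.
  case=> _ /(_ _ (@core_pt j j)) [+ _].
  by rewrite pt_mul0; [move/esym/pt_neq_theta|exact/nesym].
Qed.

Let pt_sandwich i j k l : pt k l = pt i i * pt k l * pt j j -> i = k /\ j = l.
Proof.
have [<-|nik] := pselect (i = k); last first.
  by rewrite pt_mul0 // theta_mul => /pt_neq_theta.
have [<-//|njl] := pselect (j = l).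
by rewrite pt_mul pt_mul0 => [/pt_neq_theta|]; last exact/nesym.
Qed.

(** The core consists of the matrix units [pt i j] and zero. Each condition becomes a matching of
    indices, settled by [pt_mul], [pt_mul0] and [pt_sandwich]. *)
Lemma core_class_H1 : class_H1 core.
Proof.
split; first exact: core_subsemigroup.
right; exists theta; split; first exact: core_zero.
- move=> x y /core_idempotents[->|[i ->]] /core_idempotents[->|[j ->]] //.
  by move=> nij; apply: pt_mul0 => ij; apply: nij; rewrite ij.
- move=> il ir /core_nontrivial_idempotents[i ->].
  move=> /core_nontrivial_idempotents[j ->].
  exists (pt i j); split; first by rewrite !pt_mul.
  move=> a [ca a0 aE]; case: (core_cases ca) aE => // -[k [l ->]].
  by move=> /pt_sandwich[-> ->].
- move=> a ca a0; case: (core_cases ca) => // -[k [l ->]].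
  exists (pt k k, pt l l); split.
    split; rewrite /= ?pt_mul //; apply/core_nontrivial_idempotents.
      by exists k.
    by exists l.
  move=> [p q] [/= /core_nontrivial_idempotents[i ->]].
  by move=> /core_nontrivial_idempotents[j ->] /pt_sandwich[-> ->].
- move=> a b ila ira ilb irb ca a0 cb b0.
  move=> /core_nontrivial_idempotents[i ->] /core_nontrivial_idempotents[j ->].
  move=> /core_nontrivial_idempotents[j' ->] /core_nontrivial_idempotents[k ->].
  case: (core_cases ca) => // -[? [? ->]] /pt_sandwich[<- <-].
  case: (core_cases cb) => // -[? [? ->]] /pt_sandwich[<- <-] /pt_inj[<- _].
  by rewrite pt_mul.
Qed.

(** Idempotents are subrelations of equality, and these compose by intersection. *)
Lemma hat_idempotents_band : commutative_band (idempotents hat).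
Proof.
have comm x y : x * x = x -> y * y = y -> rho (x * y) `<=` rho (y * x).
  move=> /idempotent_subE xx /idempotent_subE yy [i j].
  rewrite !rho_mul => -[k /= xik ykj].
  have ik := xx _ _ xik; have kj := yy _ _ ykj; subst.
  by exists j.
have commE x y : x * x = x -> y * y = y -> x * y = y * x.
  by move=> xx yy; apply: rho_inj; apply/seteqP; split; apply: comm.
split.
- split; first by exists theta; split; [exact: core_hat|exact: theta_mul].
  move=> _ [x [hx xx] [y [hy yy] <-]]; split; first exact: hat_mul.
  by rewrite -mulgA (mulgA y) (commE y) // -mulgA yy mulgA xx.
- by move=> x [].
- by move=> x y [_ xx] [_ yy]; exact: commE.
Qed.

Let pt_pair_id i j k e : rho e = pair_id i j ->
  pt k k = pt k k * e <-> k = i \/ k = j.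
Proof.
move=> ep; split=> [/(congr1 rho)|kij].
  rewrite rho_mul rho_pt ep => kk.
  have [a [/= _ ->]] : (single k k * pair_id i j)%g (k, k) by rewrite -kk.
  by case.
apply: rho_inj; rewrite rho_mul rho_pt ep; apply: rel_eqP => a b.
rewrite mulrelE /=; split=> [[-> ->]|[c [-> ->] []]//].
by exists k.
Qed.

Lemma unique_noncore_idempotent e1 e2 :
  nontrivial_idempotent core e1 -> nontrivial_idempotent core e2 -> e1 <> e2 ->
  exists! e, [/\ noncore_idempotents e, e1 = e1 * e & e2 = e2 * e].
Proof.
move=> /core_nontrivial_idempotents[i ->] /core_nontrivial_idempotents[j ->].
move=> nij; have {}nij : i <> j by move=> ij; apply: nij; rewrite ij.
have rE := rho_two nij (two_pair_id i j).
exists (elt (pair_id i j)); split.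
  split.
  - by apply/noncore_idempotentP; exists i, j.
  - by apply/(pt_pair_id _ rE); left.
  - by apply/(pt_pair_id _ rE); right.
move=> f [/noncore_idempotentP[k [l [nkl fE]]]].
move=> /(pt_pair_id _ fE) ikl /(pt_pair_id _ fE) jkl.
apply: rho_inj; rewrite rE fE.
case: ikl nij => ->; case: jkl => -> // _; exact: pair_idC.
Qed.

Lemma noncore_idempotent_star e : noncore_idempotents e ->
  exists e1 e2, star_pair core e e1 e2 /\
    forall f1 f2, star_pair core e f1 f2 -> [set f1; f2] = [set e1; e2].
Proof.
move=> /noncore_idempotentP[i [j [nij eE]]].
exists (pt i i), (pt j j); split.
  split.
  - by apply/core_nontrivial_idempotents; exists i.
  - by apply/core_nontrivial_idempotents; exists j.
  - by move=> /pt_inj[].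
  - by apply/(pt_pair_id _ eE); left.
  - by apply/(pt_pair_id _ eE); right.
move=> f1 f2 [/core_nontrivial_idempotents[k ->]].
move=> /core_nontrivial_idempotents[l ->] + /(pt_pair_id _ eE) kij.
move=> + /(pt_pair_id _ eE) lij.
by case: kij => ->; case: lij => -> // _; rewrite setUC.
Qed.

Lemma hat_zero : is_zero hat theta.
Proof.
split; last by move=> x _; split; [exact: theta_mul|exact: mul_theta].
  have [/card_le_trans + _ _] := core_zero; apply.
  exact/subset_card_le/core_hat.
exact: core_hat.
Qed.

(** The elements of [hat] that are not idempotent are the off-diagonal singletons and the swaps;
    neither has a fixed point. *)
Lemma hat_nonidempotent_moves y : (hat `\` idempotents hat) y ->
  forall i j, rho y (i, j) -> i <> j.
Proof.
move=> [hy ni] i j yij ij; apply: ni; split=> //; move: yij; rewrite -{}ij.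
case: (hat_cases hy) => [/core_cases[->|[k [l ->]]]|[k [l [nkl ty]]]].
- by rewrite rho_theta.
- by rewrite rho_pt => -[/= <- <-]; rewrite pt_mul.
- case: ty => yE; rewrite yE => /=; last first.
    by move=> _; apply: rho_inj; rewrite rho_mul yE pair_id_sqr.
  by move=> kl; case: nkl; case: kl => -[<- <-].
Qed.

(** As x lies in the diagonal, the products only contain pairs of y, all off the diagonal. An
    idempotent product has only diagonal pairs, so it is empty. *)
Lemma core_idempotent_mul_zero x y :
  (idempotents hat `&` core) x -> (hat `\` idempotents hat) y ->
  (x * y = theta <-> idempotents hat (x * y)) /\
  (y * x = theta <-> idempotents hat (y * x)).
Proof.
move=> [[hx xx] cx] hy; have ym := hat_nonidempotent_moves hy.
have ht : idempotents hat theta by split; [exact: core_hat|exact: theta_mul].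
split; split=> [->//|[_ /idempotent_subE p]]; apply: rho_inj;
  rewrite rho_theta -subset0 => -[i j] pij; have := p _ _ pij;
  move: pij; rewrite rho_mul => -[k /=].
  by move/idempotent_subE: xx => h /h -> /ym.
by move=> /ym + xkj; move/idempotent_subE: xx => /(_ _ _ xkj) ->.
Qed.

(** An identity u would be idempotent, hence inside the diagonal, and fixing each [pt i i] would put
    every (i,i) in it. It would then represent equality, which [hat] excludes. *)
Lemma hat_not_unital : ~ exists u, is_identity hat u.
Proof.
move=> [u [hu uE]]; suff : rho u = equality_rel by [].
apply: rel_eqP => i j; split=> [|/= <-].
  have [_ ] := uE _ hu.
  by move/idempotent_subE; apply.
have [+ _] := uE _ (core_hat (@core_pt i i)).
move=> /(congr1 rho); rewrite rho_mul rho_pt => h.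
have [k uik [/= ki _]] : (rho u * single i i)%g (i, i) by rewrite h.
by rewrite -{2}ki.
Qed.

Lemma hat_adjunction : adjunction_identity hat [set: H].
Proof.
right; split; first exact: hat_not_unital.
exists (elt equality_rel); split.
- by rewrite /hat /= rho_unit.
- apply/seteqP; split=> // x _.
  have [e|ne] := pselect (rho x = equality_rel); last by left.
  by right; apply: rho_inj; rewrite rho_unit.
- by apply: rho_inj; rewrite rho_mul rho_unit equality_mul.
- by move=> x _; split; apply: rho_inj;
    rewrite rho_mul rho_unit ?equality_mul ?mul_equality.
Qed.

Lemma noncore_idempotents_card_ge :
  `I_3 #<= [set: {e | noncore_idempotents e}].
Proof.
have h i j : i <> j -> exists e : {e | noncore_idempotents e},
    rho (sval e) = pair_id i j.
  move=> nij; have rE := rho_two nij (two_pair_id i j).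
  have ne : noncore_idempotents (elt (pair_id i j)).
    by apply/noncore_idempotentP; exists i, j.
  by exists (exist _ _ ne).
have [e01 E01] := h _ _ n01; have [e02 E02] := h _ _ n02.
have [e12 E12] := h _ _ n12.
apply: (@II3_card_le _ _ e01 e02 e12) => // e.
- by move: E02; rewrite -e E01 => /(pair_id_inj n01); tauto.
- by move: E12; rewrite -e E01 => /(pair_id_inj n01); tauto.
- by move: E12; rewrite -e E02 => /(pair_id_inj n02); tauto.
Qed.

Lemma noncore_idempotents_card_le (R : Type) (g : I -> I -> R) :
  pair_labelling g -> [set: {e | noncore_idempotents e}] #<= [set: R].
Proof.
move=> [gC gI]; apply/card_le_setTP.
(* An ordering of the pair is chosen for each idempotent. The label recovers the pair up to order,
   which is all that [pair_id] depends on. *)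
have /choice[p pP] (e : {e | noncore_idempotents e}) :
    exists p : I * I, p.1 <> p.2 /\ rho (sval e) = pair_id p.1 p.2.
  by have [i [j [nij ep _]]] := block_spec e; exists (i, j).
exists (fun a => g (p a).1 (p a).2) => e f.
have [ne eE] := pP e; have [nf fE] := pP f.
move=> /(gI _ _ _ _ ne nf) ef.
apply: eq_sig_hprop => [? ? ?|]; first exact: Prop_irrelevance.
apply: rho_inj; rewrite eE fE.
by case: ef => -[-> ->] //; exact: pair_idC.
Qed.

End BandStructure.

(** * Representing a band by rigid relations *)

Lemma card_eq_II2 (T : Type) (A : set T) : A #= `I_2 ->
  exists a b, a <> b /\ A = [set a; b].
Proof.
move=> /card_set_bijP[f [fA fI fS]].
have [a Aa fa] := fS 0%N isT; have [b Ab fb] := fS 1%N isT.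
exists a, b; split=> [ab|]; first by move: fa; rewrite ab fb.
apply/seteqP; split=> [x Ax|_ [->|->]//].
have := fA _ Ax; case fx: (f x) => [|[|//]] _; [left|right];
  by apply: fI; rewrite ?inE // fx.
Qed.

Lemma group_of_order_two (S : semigroupType) (A : set S) :
  is_group A -> A #= `I_2 ->
  exists e s, [/\ e <> s, A = [set e; s], e * e = e, e * s = s &
                  s * e = s /\ s * s = e].
Proof.
move=> [[_ AA] [e [Ae eA] invA]] /card_eq_II2[a [b [nab AE]]].
have [s [nes As {}AE]] : exists s, [/\ e <> s, A s & A = [set e; s]].
  move: Ae; rewrite AE => -[->|->].
    by exists b; split=> //; right.
  by exists a; split; [exact/nesym|left|exact: setUC].
have [es se] := eA _ As; exists e, s; split=> //; first exact: (eA _ Ae).1.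
split=> //; have : A (s * s) by apply: AA; exists s => //; exists s.
(* If [s * s = s], multiplying by the inverse of s would give s = e. *)
rewrite {1}AE => -[//|/= ss]; have [t _ [st _]] := invA _ As.
by case: nes; rewrite -st -{1}ss -mulgA st se.
Qed.

Section Representation.
Variables (H : semigroupType) (hatH : set H) (Omega : Type).
Variables (Ha : Omega -> set H) (C : set H) (theta : H).
Hypothesis hatH_band : band_with_core hatH Ha C.
Hypothesis C_H1 : class_H1 C.
Hypothesis Ha_group : forall a, is_group (Ha a) /\ Ha a #= `I_2.
Hypothesis Omega_ge3 : `I_3 #<= [set: Omega].
Hypothesis hatE_band : commutative_band (idempotents hatH).
Hypothesis pair_idempotent : forall e1 e2, nontrivial_idempotent C e1 ->
  nontrivial_idempotent C e2 -> e1 <> e2 ->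
  exists! e, [/\ (idempotents hatH `\` C) e, e1 = e1 * e & e2 = e2 * e].
Hypothesis idempotent_pair : forall e, (idempotents hatH `\` C) e ->
  exists e1 e2, star_pair C e e1 e2 /\
    forall f1 f2, star_pair C e f1 f2 -> [set f1; f2] = [set e1; e2].
Hypothesis theta_zero : is_zero hatH theta.
Hypothesis zero_iff : forall x y,
  (idempotents hatH `&` C) x -> (hatH `\` idempotents hatH) y ->
  (x * y = theta <-> idempotents hatH (x * y)) /\
  (y * x = theta <-> idempotents hatH (y * x)).
Hypothesis hatH_adj : adjunction_identity hatH [set: H].

Implicit Types (x y e : H).
Let nid := nontrivial_idempotent C.
Let I := {i : H | nid i}.
Implicit Types (i j k l : I).

Let C_hatH : C `<=` hatH. Proof. by have [[]] := hatH_band. Qed.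

Let C_mulr x y : C x -> hatH y -> C (x * y).
Proof.
have [[_ _ h _] _ _ _ _] := hatH_band => cx hy.
by apply: h; exists x => //; exists y.
Qed.

Let C_mull x y : hatH x -> C y -> C (x * y).
Proof.
have [[_ _ _ h] _ _ _ _] := hatH_band => hx cy.
by apply: h; exists x => //; exists y.
Qed.

Let hatH_theta : hatH theta. Proof. by have [] := theta_zero. Qed.
Let theta_mul x : hatH x -> theta * x = theta.
Proof. by have [_ _ h] := theta_zero => /h[]. Qed.
Let mul_theta x : hatH x -> x * theta = theta.
Proof. by have [_ _ h] := theta_zero => /h[]. Qed.

(** An ideal absorbs: theta is the product of theta with any element of [C]. *)
Let C_theta : C theta.
Proof.
have [[[[x Cx] _] _ _ _] _ _ _ _] := hatH_band.
by rewrite -(theta_mul (C_hatH Cx)); exact: C_mull.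
Qed.

Let block_spec x : hatH x -> ~ C x -> exists a, Ha a x.
Proof.
move=> hx ncx; have [_ _ [cov _ _] _ _] := hatH_band.
have : (hatH `\` C) x by [].
by rewrite -cov => -[a _ ax]; exists a.
Qed.

Let block_sub a x : Ha a x -> hatH x /\ ~ C x.
Proof.
move=> ax; have [_ _ [cov _ _] _ _] := hatH_band.
have : (hatH `\` C) x by rewrite -cov; exists a.
by [].
Qed.

Let block_inj a b x : Ha a x -> Ha b x -> a = b.
Proof.
move=> ax bx; have [_ _ [_ triv _] _ _] := hatH_band.
by apply: triv => //; exists x.
Qed.

Let block_group a : exists e s,
  [/\ e <> s, Ha a = [set e; s], e * e = e, e * s = s & s * e = s /\ s * s = e].
Proof. by have [] := Ha_group a; exact: group_of_order_two. Qed.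

Let block_idempotent a : exists2 e, Ha a e & (idempotents hatH `\` C) e.
Proof.
have [e [s [_ aE ee _ _]]] := block_group a.
have ae : Ha a e by rewrite aE; left.
by have [he nce] := block_sub ae; exists e.
Qed.

Let Omega_two : exists a b : Omega, a <> b.
Proof.
apply: contrapT => n2.
have [a|no] := pselect (inhabited Omega); last first.
  suff : `I_3 #<= `I_2 by rewrite card_le_II.
  apply: (card_le_trans Omega_ge3).
  have -> : [set: Omega] = set0 by rewrite -subset0 => a _; case: no.
  exact: card_ge0.
case: a => a.
suff : `I_3 #<= `I_2 by rewrite card_le_II.
apply: (card_le_trans Omega_ge3).
apply: (@subset2_card_le_II _ _ a a) => b _; left.
by apply: contrapT => ba; apply: n2; exists b, a.
Qed.

(** The one-element case of H_1 is impossible, since by (ii_4) the idempotent of a block yields two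
    distinct elements of [C]. The zero of [C] is then the zero of [hatH], as [C] contains theta. *)
Let H1_facts :
  [/\ is_zero C theta,
       forall x y, idempotents C x -> idempotents C y -> x <> y ->
         x * y = theta,
       forall il ir, nid il -> nid ir ->
         exists! a, [/\ C a, a <> theta & a = il * a * ir],
       forall a, C a -> a <> theta ->
         exists p q, [/\ nid p, nid q & a = p * a * q]
     & forall a b ila ira irb,
         C a -> a <> theta -> C b -> b <> theta ->
         nid ila -> nid ira -> nid irb ->
         a = ila * a * ira -> b = ira * b * irb ->
         a * b <> theta].
Proof.
have [_ [C1|[th [z orth uni fac nz]]]] := C_H1.
  exfalso; have [a _] := Omega_two.
  have [e _ he] := block_idempotent a.
  have [e1 [e2 [[[[c1 _] _ _] [[c2 _] _ _] n12 _ _] _]]] := idempotent_pair he.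
  have := II2_card_le c1 c2 n12.
  by rewrite (card_le_eqr C1) card_le_II.
have thE : th = theta.
  have [_ _ /(_ _ C_theta)[<- _]] := z.
  by have [_ /C_hatH/mul_theta] := z.
move: z orth uni fac nz; rewrite thE => z orth uni fac nz; split=> //.
  by move=> a ca a0; have [[p q] [[/= np nq aE] _]] := fac _ ca a0; exists p, q.
by move=> a b k l m ca a0 cb b0 nk nl nm ak bm; exact: (nz a b k l l m).
Qed.

Let nidC i : C (sval i). Proof. by have [[]] := svalP i. Qed.
Let nid_hatH i : hatH (sval i). Proof. exact/C_hatH/nidC. Qed.
Let nidI i : sval i * sval i = sval i. Proof. by have [[]] := svalP i. Qed.
Let nid_neq0 i : sval i <> theta.
Proof.
by move=> i0; have [_ + _] := svalP i; apply; rewrite i0; have [] := H1_facts.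
Qed.
Let nid_inj i j : sval i = sval j -> i = j.
Proof. by case: i j => [x hx] [y hy] /= xy; exact: eq_exist. Qed.
Let nid_orth i j : i <> j -> sval i * sval j = theta.
Proof.
move=> nij; have [_ orth _ _ _] := H1_facts; apply: orth.
- by have [] := svalP i.
- by have [] := svalP j.
- by move/nid_inj.
Qed.

(** With only two nontrivial idempotents in the core, the idempotents of two different blocks would
    both be attached to that one pair, against uniqueness in (ii_4). *)
Let three_nids : exists i0 i1 i2 : I, [/\ i0 <> i1, i0 <> i2 & i1 <> i2].
Proof.
apply: contrapT => n3; have [a [b nab]] := Omega_two.
have [e ae he] := block_idempotent a; have [f bf hf] := block_idempotent b.
have [e1 [e2 [[n1 n2 n12 e1e e2e] _]]] := idempotent_pair he.
have [f1 [f2 [[m1 m2 m12 f1f f2f] _]]] := idempotent_pair hf.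
have third x : nid x -> x = e1 \/ x = e2.
  move=> nx; apply: contrapT => /not_orP[x1 x2]; apply: n3.
  exists (exist _ e1 n1), (exist _ e2 n2), (exist _ x nx).
  by split=> -[] // /esym.
have ef : e = f; last by apply: nab; apply: (block_inj ae); rewrite ef.
have [g [_ gU]] := pair_idempotent n1 n2 n12.
rewrite -(gU e) // -(gU f) //; split=> //.
all: by case: (third _ m1) m12 => m1E; case: (third _ m2) => m2E; congruence.
Qed.

(** The identity is really adjoined. If [hatH] had an identity u, it would lie outside [C], as
    otherwise [C = hatH]; being a right identity for all three nontrivial idempotents found above,
    it would violate the [exactly two] of (ii_4). *)
Let unit_exists : exists u, [/\ forall x, hatH x \/ x = u, ~ hatH u,
  u * u = u & forall x, hatH x -> u * x = x /\ x * u = x].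
Proof.
case: hatH_adj => [[[u [hu uE]] _]|[_ [u [nu HE uu uE]]]]; last first.
  exists u; split=> // x; have : [set: H] x by [].
  by rewrite HE.
exfalso; have [_ nC _ _ _] := hatH_band.
have ncu : ~ C u.
  move=> Cu; apply: nC; apply/seteqP; split=> // x hx.
  by rewrite -(uE _ hx).1; exact: C_mulr.
have eu : (idempotents hatH `\` C) u.
  by split=> //; split=> //; exact: (uE _ hu).1.
have [e1 [e2 [_ uniq]]] := idempotent_pair eu.
have [i0 [i1 [i2 [n01 n02 n12]]]] := three_nids.
have st i j : i <> j -> star_pair C u (sval i) (sval j).
  move=> nij; split; [exact: svalP|exact: svalP|by move/nid_inj| |];
    by rewrite (uE _ (nid_hatH _)).2.
have : [set sval i0; sval i1] (sval i2).
  by rewrite (uniq _ _ (st _ _ n01)) -(uniq _ _ (st _ _ n02)); right.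
by case=> /= /nid_inj; exact/nesym.
Qed.

Let core_mulr x y : C x -> C (x * y).
Proof.
move=> cx; have [u [cov _ _ uE]] := unit_exists.
by case: (cov y) => [|->]; [exact: C_mulr|rewrite (uE _ (C_hatH cx)).2].
Qed.

Let core_mull x y : C y -> C (x * y).
Proof.
move=> cy; have [u [cov _ _ uE]] := unit_exists.
by case: (cov x) => [hx|->]; [exact: C_mull|rewrite (uE _ (C_hatH cy)).1].
Qed.

Let zero_mul x : theta * x = theta.
Proof.
have [u [cov _ _ uE]] := unit_exists.
by case: (cov x) => [|->]; [exact: theta_mul|exact: (uE _ hatH_theta).2].
Qed.

Let mul_zero x : x * theta = theta.
Proof.
have [u [cov _ _ uE]] := unit_exists.
by case: (cov x) => [|->]; [exact: mul_theta|exact: (uE _ hatH_theta).1].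
Qed.

Let factor x : C x -> x <> theta ->
  exists i j, x = sval i * x * sval j.
Proof.
have [_ _ _ fac _] := H1_facts => cx x0.
have [p [q [np nq xE]]] := fac _ cx x0.
by exists (exist _ p np), (exist _ q nq).
Qed.

Let sandwich_eq i j x y : C x -> C y -> x <> theta -> y <> theta ->
  x = sval i * x * sval j -> y = sval i * y * sval j -> x = y.
Proof.
move=> cx cy x0 y0 xE yE; have [_ _ uni _ _] := H1_facts.
have [a [_ aU]] := uni _ _ (svalP i) (svalP j).
by rewrite -(aU x) // -(aU y).
Qed.

Definition action x : binrel I := fun p => sval p.1 * x * sval p.2 <> theta.

(** By condition (4) of H_1, x has left and right idempotent factors k and l. Orthogonality of
    distinct idempotents forces i = k and j = l. *)
Let core_action x i j : C x -> action x (i, j) -> x = sval i * x * sval j.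
Proof.
move=> cx xij; have x0 : x <> theta.
  by move=> x0; apply: xij; rewrite /= x0 mul_zero zero_mul.
have [k [l xE]] := factor cx x0.
have [->|nik] := pselect (i = k); last first.
  by case: xij; rewrite /= xE !mulgA nid_orth // !zero_mul.
have [->//|njl] := pselect (j = l).
by case: xij; rewrite /= xE -!mulgA nid_orth ?mul_zero //; exact/nesym.
Qed.

Let action_core x i j : x <> theta -> x = sval i * x * sval j ->
  action x (i, j).
Proof. by move=> x0 xE; rewrite /action /= -xE. Qed.

(** Since [sval i * x] is in the core, condition (4) gives it a right factor j. By orthogonality
    this j is the only possible image of i under [action x]. *)
Let mul_left i x : sval i * x <> theta ->
  exists j, sval i * x = sval i * x * sval j.
Proof.
move=> ix0; have [k [j ixE]] := factor (core_mulr x (nidC i)) ix0.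
by exists j; rewrite [in RHS]ixE -mulgA nidI -ixE.
Qed.

Let action_mul x y : action (x * y) = action x * action y.
Proof.
apply: rel_eqP => i j; split=> [|[k /= xik ykj]]; rewrite /action /=.
  rewrite !mulgA => xy0.
  (* The intermediate point is the right factor of [sval i * x]. *)
  have [k ixE] : exists k, sval i * x = sval i * x * sval k.
    by apply: mul_left => ix0; apply: xy0; rewrite ix0 !zero_mul.
  exists k; rewrite /action /= => h; apply: xy0.
    by rewrite ixE h !zero_mul.
  by rewrite ixE -!mulgA (mulgA (sval k)) h !mul_zero.
(* Conversely, condition (5) makes the product of the nonzero elements i x k and k y j nonzero. It
   equals i x y j because k is the right factor of i x. *)
have [_ _ _ _ nz] := H1_facts.
have ix0 : sval i * x <> theta by move=> h; apply: xik; rewrite /= h zero_mul.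
have [l ixE] := mul_left ix0.
have kl : k = l.
  apply: contrapT => nkl; apply: xik.
  by rewrite /= ixE -mulgA nid_orth ?mul_zero //; exact/nesym.
subst l; have := nz _ _ _ _ _ _ xik _ ykj (svalP i) (svalP k) (svalP j).
rewrite /= -!mulgA !nidI !(mulgA (sval i) (sval i)).
rewrite !(mulgA (sval k) (sval k)) !nidI.
rewrite !mulgA -ixE; apply=> //.
  by rewrite ixE; exact/core_mull/nidC.
exact/core_mull/nidC.
Qed.

Let core_small x : C x -> small (action x).
Proof.
move=> cx [i j] [k l] xij xkl.
have ik : i = k.
  apply: contrapT => nik; apply: xij; rewrite /= (core_action cx xkl) !mulgA.
  by rewrite nid_orth // !zero_mul.
have jl : j = l.
  apply: contrapT => njl; apply: xij; rewrite /= (core_action cx xkl) -!mulgA.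
  by rewrite nid_orth ?mul_zero //; exact/nesym.
by rewrite ik jl.
Qed.

(** A nonzero core element is recovered from the single pair of its relation by the uniqueness in
    condition (3). *)
Let core_inj x y : C x -> C y -> action x = action y -> x = y.
Proof.
move=> cx cy xy.
have h z w : C z -> C w -> action z = action w -> z <> theta -> z = w.
  move=> cz cw zw z0; have [i [j zE]] := factor cz z0.
  have zij := action_core z0 zE; have wij := zij; rewrite zw in wij.
  have wE := core_action cw wij.
  by apply: (sandwich_eq cz cw z0 _ zE wE); rewrite wE.
have [x0|x0] := pselect (x = theta); last exact: h.
have [y0|y0] := pselect (y = theta); first by rewrite x0 y0.
by apply/esym; apply: h.
Qed.

(** The correspondence of (ii_4) between idempotents outside the core and pairs of points, on
    ordered pairs. *)
Definition linked e i j : Prop :=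
  [/\ (idempotents hatH `\` C) e, i <> j, sval i = sval i * e
    & sval j = sval j * e].

Let linked_exists e : (idempotents hatH `\` C) e -> exists i j, linked e i j.
Proof.
move=> he; have [e1 [e2 [[n1 n2 n12 e1e e2e] _]]] := idempotent_pair he.
by exists (exist _ e1 n1), (exist _ e2 n2); split=> // -[].
Qed.

Let linked_of_pair i j : i <> j -> exists e, linked e i j.
Proof.
move=> nij; have [|e [[he ie je] _]] := pair_idempotent (svalP i) (svalP j).
  by move/nid_inj.
by exists e.
Qed.

Let linked_star e i j : linked e i j -> star_pair C e (sval i) (sval j).
Proof.
by case=> he nij ie je; split=> //; [exact: svalP|exact: svalP|move/nid_inj].
Qed.

Let linked_uniq e f i j : linked e i j -> linked f i j -> e = f.
Proof.
move=> [he nij ie je] [hf _ if_ jf].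
have [|g [_ gU]] := pair_idempotent (svalP i) (svalP j); first by move/nid_inj.
by rewrite -(gU e) // -(gU f).
Qed.

Let linked_comm e i j k : linked e i j -> e * sval k = sval k * e.
Proof.
move=> [[ee _] _ _ _]; have [_ _ h] := hatE_band; apply: h => //.
Qed.

(** By (ii_3), k * e is an idempotent of the core. If it differs from k, orthogonality gives k * e =
    k * (k * e) = theta; if it equals k, then e would be attached to a third point. *)
Let linked_other e i j k : linked e i j -> k <> i -> k <> j ->
  sval k * e = theta.
Proof.
move=> lk ki kj; have [he nij ie je] := lk; have [ee _] := he.
apply: contrapT => ke0; have [_ orth _ _ _] := H1_facts.
have kk := svalP k; have [kI _ _] := kk.
have eI : idempotents C (sval k * e).
  split; first exact/core_mulr/nidC.
  have [_ h _] := hatE_band; apply: h.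
  have [[_ h'] _ _] := hatE_band; apply: h'.
  by exists (sval k); [split; [exact: nid_hatH|exact: nidI]|exists e].
have kE : sval k = sval k * e.
  apply: contrapT => nk; apply: ke0.
  by rewrite -(orth _ _ kI eI nk) mulgA nidI.
have [e1 [e2 [_ uniq]]] := idempotent_pair he.
have lki : linked e k i by split=> //; case: lk.
have : [set sval i; sval j] (sval k).
  by rewrite (uniq _ _ (linked_star lk)) -(uniq _ _ (linked_star lki)); left.
by case=> /= /nid_inj.
Qed.

Let action_unit u : (forall x, hatH x -> u * x = x /\ x * u = x) ->
  action u = equality_rel.
Proof.
move=> uE; apply: rel_eqP => i j; rewrite /action /= (uE _ (nid_hatH i)).2.
split=> [ij|->]; last by rewrite nidI; exact: nid_neq0.
by apply: contrapT => /nid_orth.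
Qed.

Let action_linked e i j : linked e i j -> action e = pair_id i j.
Proof.
move=> lk; have [_ nij ie je] := lk; apply: rel_eqP => k l; rewrite /action /=.
have [ki|nk] := pselect (k = i \/ k = j); last first.
  split=> [|[_ //]]; rewrite (@linked_other e i j) ?zero_mul //.
  - by move=> ki; apply: nk; left.
  - by move=> kj; apply: nk; right.
have -> : sval k * e = sval k by case: ki => ->.
split=> [kl|[<- _]]; last by rewrite nidI; exact: nid_neq0.
by split=> //; apply: contrapT => /nid_orth.
Qed.

(* A fixed point k of s would make k * s = k a nonzero idempotent, against
   (ii_5). *)
Let action_flip e s i j : linked e i j -> hatH s -> s <> e ->
  e * s = s -> s * e = s -> s * s = e -> action s = swap i j.
Proof.
move=> lk hs nse es se ss; have [[ee nce] nij ie je] := lk.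
have ns : (hatH `\` idempotents hatH) s.
  by split=> // -[_ ss']; apply: nse; rewrite -ss.
have outl k l : k <> i -> k <> j -> ~ action s (k, l).
  by move=> ki kj; apply; rewrite /= -es mulgA (linked_other lk) // !zero_mul.
have outr k l : l <> i -> l <> j -> ~ action s (k, l).
  move=> li lj; apply; rewrite /= -se -!mulgA (linked_comm _ lk).
  by rewrite (linked_other lk) // !mul_zero.
have nfix k : ~ action s (k, k).
  move=> skk; have ks0 : sval k * s <> theta.
    by move=> h; apply: skk; rewrite /= h zero_mul.
  have [l ksl] := mul_left ks0.
  have lk' : l = k.
    apply: contrapT => nlk; apply: skk.
    by rewrite /= ksl -mulgA nid_orth ?mul_zero.
  subst l.
  have cks : C (sval k * s) by exact/core_mulr/nidC.
  have ksE : sval k * s = sval k.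
    apply: (sandwich_eq (i := k) (j := k) cks (nidC k) ks0 (@nid_neq0 k)).
      by rewrite mulgA nidI.
    by rewrite !nidI.
  have kI : (idempotents hatH `&` C) (sval k).
    by split; [split; [exact: nid_hatH|exact: nidI]|exact: nidC].
  by apply: ks0; apply/(zero_iff kI ns).1; rewrite ksE; case: kI.
(* k * s is nonzero because k = k * s * s, so k has an image. It is not k itself by [nfix], and it
   stays in {i,j} by [outr]; only m is left. *)
have move_to k m : linked e k m -> action s (k, m).
  move=> lkm; have [_ nkm ke me] := lkm.
  have ks0 : sval k * s <> theta.
    by move=> h; apply: (@nid_neq0 k); rewrite ke -ss mulgA h zero_mul.
  have [l ksl] := mul_left ks0.
  have skl : action s (k, l) by rewrite /action /= -ksl.
  suff : l = m by move=> <-.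
  apply: contrapT => nlm; have [lk'|nlk] := pselect (l = k).
    by subst l; exact: nfix skl.
  have kij : (k = i \/ k = j) /\ (m = i \/ m = j).
    split; apply: contrapT => /not_orP[ki kj].
      by apply: (@nid_neq0 k); rewrite ke (linked_other lk).
    by apply: (@nid_neq0 m); rewrite me (linked_other lk).
  by apply: (outr k l) => // h; subst l; case: kij => -[] ? [] ?; congruence.
have lk' : linked e j i by split=> //; exact/nesym.
apply: rel_eqP => k l; split=> [skl|]; last first.
  by case=> /= -[-> ->]; exact: move_to.
have [ki|ki] := pselect (k = i).
  left; split=> //=; apply: contrapT => lj; apply: (outr k l _ lj skl) => li.
  by subst; exact: nfix skl.
have [kj|kj] := pselect (k = j); last by case: (outl k l ki kj).
right; split=> //=; apply: contrapT => li; apply: (outr k l li _ skl) => lj.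
by subst; exact: nfix skl.
Qed.

Let block_action a : exists e s i j, [/\ linked e i j, Ha a = [set e; s],
  s * s = e, action e = pair_id i j & action s = swap i j].
Proof.
have [e [s [nes aE ee es [se ss]]]] := block_group a.
have ae : Ha a e by rewrite aE; left.
have as_ : Ha a s by rewrite aE; right.
have [he nce] := block_sub ae; have [hs _] := block_sub as_.
have [i [j lk]] : exists i j, linked e i j by exact: linked_exists.
exists e, s, i, j; split=> //; first exact: action_linked.
by apply: (action_flip lk) => //; exact/nesym.
Qed.

Let noncore_two x : hatH x -> ~ C x -> exists i j, i <> j /\ two i j (action x).
Proof.
move=> hx ncx; have [a ax] := block_spec hx ncx.
have [e [s [i [j [[_ nij _ _] aE _ eE sE]]]]] := block_action a.
exists i, j; split=> //.
by move: ax; rewrite aE => -[->|->]; [right|left].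
Qed.

(** Both elements of a block have the same [pair_id] as the relation of their square. Equal
    relations therefore give equal pairs, equal block identities and equal blocks, and inside a
    block [swap] and [pair_id] differ. *)
Let noncore_inj x y : hatH x -> ~ C x -> hatH y -> ~ C y ->
  action x = action y -> x = y.
Proof.
move=> hx ncx hy ncy xy.
have [a ax] := block_spec hx ncx; have [b bY] := block_spec hy ncy.
have [e [s [i [j [lk aE ss eE sE]]]]] := block_action a.
have [f [t [k [l [lk' bE tt fE tE]]]]] := block_action b.
have nij : i <> j by case: lk.
have nkl : k <> l by case: lk'.
have ef : e = f.
  have sq z : z = e \/ z = s -> action (z * z) = pair_id i j.
    by rewrite action_mul => -[->|->]; rewrite ?eE ?sE ?swap_sqr ?pair_id_sqr.
  have sq' z : z = f \/ z = t -> action (z * z) = pair_id k l.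
    by rewrite action_mul => -[->|->]; rewrite ?fE ?tE ?swap_sqr ?pair_id_sqr.
  move: ax bY; rewrite aE bE => xes yft.
  have : pair_id i j = pair_id k l.
    by rewrite -(sq x xes) -(sq' y yft) !action_mul xy.
  case/(pair_id_inj nij) => -[ik jl]; subst; apply: (linked_uniq lk) => //.
  by case: lk' => *; split.
have ab : a = b by apply: (@block_inj _ _ e); rewrite ?aE ?bE ef; left.
move: ax bY xy; rewrite -ab aE => -[->|->] [->|->] //; rewrite eE sE.
  by move/esym/(swap_neq_pair_id nij).
by move/(swap_neq_pair_id nij).
Qed.

Lemma band_rigid_representable (R : Type) :
  [set: Omega] #<= [set: R] -> rigid_representable R H.
Proof.
move=> /card_le_setTP[lab lab_inj].
have [i0 [i1 [i2 [n01 n02 n12]]]] := three_nids.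
have [u [cov nu uu uE]] := unit_exists.
have uA := action_unit uE.
have [a0 _] := Omega_two.
(* A pair is sent to the block of its linked idempotent, and its label will be that of the block;
   [a0] is the default on the diagonal. *)
have /choice[om omP] (p : I * I) : exists a, p.1 <> p.2 ->
    exists2 e, Ha a e & linked e p.1 p.2.
  have [->|nij] := pselect (p.1 = p.2); first by exists a0.
  have [e lk] := linked_of_pair nij; have [[[he _] nce] _ _ _] := lk.
  by have [a ae] := block_spec he nce; exists a => _; exists e.
exists I, i0, i1, i2, (fun i j => lab (om (i, j))); split=> //.
  split=> [i j nij|i j k l nij nkl /lab_inj omE].
    have [e ae lk] := omP (i, j) nij; have [f af lk'] := omP (j, i) (nesym nij).
    congr lab; apply: block_inj ae _.
    suff -> : e = f by [].
    by apply: (linked_uniq lk); case: lk' => *; split.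
  have [e ae lk] := omP (i, j) nij; have [f af lk'] := omP (k, l) nkl.
  rewrite omE in ae.
  have [x [s [_ aE xx xs [sx ss]]]] := block_group (om (k, l)).
  (* A block contains one idempotent only, so pairs with the same block share their linked
     idempotent and hence coincide. *)
  have idem z : z * z = z -> Ha (om (k, l)) z -> z = x.
    by move=> zz; rewrite aE => -[//|zs]; move: zz; rewrite zs ss.
  have ee : e * e = e by case: lk => -[[]].
  have ff : f * f = f by case: lk' => -[[]].
  apply: pair_id_inj nij _.
  by rewrite -(action_linked lk) -(action_linked lk') (idem e) // (idem f).
(* The three kinds of elements match the three kinds of rigid relations; injectivity is checked kind
   by kind. *)
have actT x : x = u \/ C x \/ exists i j, i <> j /\ two i j (action x).
  have [hx|] := cov x; last by left.
  by have [cx|/(noncore_two hx)] := pselect (C x); right; [left|right].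
exists action; last by move=> x y _ _; exact: action_mul.
split=> [x _|x y _ _ xy|r].
- by case: (actT x) => [->|[/core_small sx|[i [j h]]]];
    [exact: Or31|exact: Or32|apply: Or33; exists i, j].
- have neqC z : C z -> action z <> equality_rel.
    by move/core_small; apply: small_neq_equality n01 _.
  have neq2 z i j : two i j (action z) -> action z <> equality_rel.
    exact: (two_neq_equality n01 n02 n12).
  have uU z : action z = equality_rel -> z = u.
    by case: (actT z) => [//|[/neqC//|[i [j [_ /neq2]]]]].
  have [xu|nxu] := pselect (action x = equality_rel).
    by rewrite (uU x) // (uU y) // -xy.
  have nC z : hatH z -> ~ C z -> ~ small (action z).
    by move=> hz /(noncore_two hz)[i [j [nij /(two_not_small nij)]]].
  have hx : hatH x by case: (cov x) => // xu; case: nxu; rewrite xu.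
  have hy : hatH y by case: (cov y) => // yu; case: nxu; rewrite xy yu.
  have [cx|ncx] := pselect (C x); have [cy|ncy] := pselect (C y).
  + exact: core_inj.
  + by case: (nC y hy ncy); rewrite -xy; exact: core_small.
  + by case: (nC x hx ncx); rewrite xy; exact: core_small.
  + exact: noncore_inj.
- case=> [->|/smallP[->|[i [j ->]]]|[i [j [nij tr]]]].
  + by exists u.
  + exists theta => //; apply: rel_eqP => i j; split=> //.
    by rewrite /action /= mul_zero zero_mul.
  (* The existence part of condition (3) provides the element acting as [single i j]. *)
  + have [_ _ uni _ _] := H1_facts.
    have [a [[ca a0' aE] _]] := uni _ _ (svalP i) (svalP j).
    exists a => //; have aij := action_core a0' aE.
    apply: rel_eqP => k l; split=> [akl|[/= -> ->]//].
    by have [-> ->] := core_small ca akl aij.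
  (* The block of the idempotent linked to {i,j} contains an element for [pair_id i j] and one for
     [swap i j]. *)
  + have [e lk] := linked_of_pair nij; have [[[he _] nce] _ _ _] := lk.
    have [a ae] := block_spec he nce.
    have [f [s [k [l [lk' aE ss fE sE]]]]] := block_action a.
    have nkl : k <> l by case: lk'.
    have ef : e = f.
      move: ae; rewrite aE => -[//|es].
      by rewrite -ss -es; case: lk => -[[_ ->]].
    have := action_linked lk; rewrite ef fE => /esym/(pair_id_inj nij) klij.
    have {tr} : two k l r by case: klij => -[<- <-] //; exact: two_sym.
    by case=> ->; [exists s|exists f].
Qed.

End Representation.

Theorem theorem4p23 (R : realType) (H : semigroupType)
    (H_nonempty : [set: H] !=set0) :
  (exists (X : Type) (d : X * X -> R),
    [/\ [set: X] !=set0, pseudometric d, ~ discrete_pseudometric d,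
        strongly_rigid d
      & isomorphic [set: H] (generated (fibers d : set (binrel X)))])
  <->
  (exists hatH : set H,
    [/\ subsemigroup hatH,
        adjunction_identity hatH [set: H]
      & exists (Omega : Type) (Ha : Omega -> set H) (C : set H),
        let hatE := idempotents hatH in
        [/\ (* ii_1 *)
            [/\ band_with_core hatH Ha C, class_H1 C
              & forall alpha, is_group (Ha alpha) /\ Ha alpha #= `I_2],
            (* ii_2 *)
            `I_3 #<= [set: Omega] /\ [set: Omega] #<= [set: R],
            (* ii_3 *)
            commutative_band hatE,
            (* ii_4 *)
            (forall e1 e2, nontrivial_idempotent C e1 ->
               nontrivial_idempotent C e2 -> e1 <> e2 ->
               exists! e, [/\ (hatE `\` C) e, e1 = e1 * e & e2 = e2 * e]) /\
            (forall e, (hatE `\` C) e ->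
               exists e1 e2, star_pair C e e1 e2 /\
                 forall f1 f2, star_pair C e f1 f2 ->
                   [set f1; f2] = [set e1; e2])
          & (* ii_5 *)
            exists2 theta, is_zero hatH theta &
              forall x y, (hatE `&` C) x -> (hatH `\` hatE) y ->
                (x * y = theta <-> idempotents hatH (x * y)) /\
                (y * x = theta <-> idempotents hatH (y * x))]]).
Proof.
split=> [[X [d [X0 d_pm d_nd d_rigid iso]]]|[hatH [_ adj [Omega [Ha [C]]]]]].
  have [I [i0 [i1 [i2 [g [n01 n02 n12 g_lab [rho [rhoM rhoI rhoS] rho_mul]]]]]]]
    := rigid_pseudometric_representable X0 d_pm d_nd d_rigid iso.
  have rho_rigid x : rigid (rho x) by exact: rhoM.
  have rho_inj : injective rho by move=> x y; apply: rhoI; rewrite inE.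
  have {}rho_mul x y : rho (x * y) = rho x * rho y by exact: rho_mul.
  have [x0 _] := H_nonempty.
  (* A section of [rho] over the rigid relations, with [x0] as default elsewhere. *)
  have /choice[elt eltK] (r : binrel I) : exists x, rigid r -> rho x = r.
    by have [/rhoS[x _ <-]|nr] := pselect (rigid r); [exists x|exists x0].
  exists (hat rho); split.
  - exact: (hat_subsemigroup n01 n02 n12 rho_rigid rho_mul eltK).
  - exact: (hat_adjunction n01 rho_rigid rho_inj rho_mul eltK).
  exists {e | noncore_idempotents rho e}, (block (rho := rho)), (core rho).
  split.
  - split.
    + exact: (hat_band_with_core n01 n02 n12 rho_rigid rho_inj rho_mul eltK).
    + exact: (core_class_H1 n01 n02 n12 rho_rigid rho_inj rho_mul eltK).
    + exact: (block_group n01 n02 n12 rho_rigid rho_inj rho_mul eltK).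
  - split.
    + exact: (noncore_idempotents_card_ge
        n01 n02 n12 rho_rigid rho_inj rho_mul eltK).
    + exact: (noncore_idempotents_card_le
        n01 n02 n12 rho_rigid rho_inj rho_mul g_lab).
  - exact: (hat_idempotents_band
        n01 n02 n12 rho_rigid rho_inj rho_mul eltK).
  - split.
    + exact: (unique_noncore_idempotent
        n01 n02 n12 rho_rigid rho_inj rho_mul eltK).
    + exact: (noncore_idempotent_star
        n01 n02 n12 rho_rigid rho_inj rho_mul eltK).
  - exists (elt set0).
      exact: (hat_zero n01 rho_inj rho_mul eltK).
    exact: (core_idempotent_mul_zero n01 rho_rigid rho_inj rho_mul eltK).
case=> -[band cH1 grp] [ge3 leR] comm [pair1 pair2] [theta z ziff].
apply: representable_rigid_pseudometric.
exact: (band_rigid_representable band cH1 grp ge3 comm pair1 pair2 z ziff adj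
          leR).
Qed.
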